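(* Let $\mathcal{X}=(X,d_X,f_X)$ be a finite generic augmented metric space, let $\mathcal{K}$ be its $\mathbb{Z}^2$-indexed Rips filtration, and let $M:=\mathrm{H}_0(\mathcal{K}):\mathbb{Z}^2\to\mathbf{Vec}$. Let $\beta_i^M:\mathbb{Z}^2\to\mathbb{Z}_{\ge0}$ be the $i$-th graded Betti number of $M$ and let $\gamma_j^{\mathcal{X}}$ be the $j$-th elder-rule feature function of $(X,d_X^{\mathbb{Z}},f_X^{\mathbb{Z}})$, restricted to $\mathbb{Z}^2$. Then $$\beta_0^M=\gamma_0^{\mathcal{X}},\qquad \beta_1^M=\gamma_1^{\mathcal{X}}-\gamma_2^{\mathcal{X}},\qquad \beta_2^M=\gamma_2^{\mathcal{X}}-\gamma_1^{\mathcal{X}},$$ where for $\alpha,\alpha':\mathbb{Z}^2\to\mathbb{Z}_{\ge0}$ the difference is the truncated one, $(\alpha-\alpha')(\mathbf{x}):=\max(\alpha(\mathbf{x})-\alpha'(\mathbf{x}),0)$.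
   Context: **$\mathbb{Z}^2$-indexed Rips filtration.** A finite augmented metric space is a triple $(X,d_X,f_X)$ with $(X,d_X)$ a finite metric space and $f_X:X\to\mathbb{R}$. It is generic if $f_X$ is injective and different pairs of distinct points have different distances. Write $X=\{x_1,\dots,x_n\}$ with $f_X(x_1)<\dots<f_X(x_n)$. Define $f_X^{\mathbb{Z}}(x_i)=i$; define $d_X^{\mathbb{Z}}(x_i,x_i)=0$ and, for $i\ne j$, $d_X^{\mathbb{Z}}(x_i,x_j)=\ell\in\{1,\dots,\binom n2\}$ if $d_X(x_i,x_j)$ is the $\ell$-th smallest nonzero distance ($d_X^{\mathbb{Z}}$ need not satisfy the triangle inequality). The $\mathbb{Z}^2$-indexed Rips filtration $\mathcal{K}$ sends $(a,b)\in\mathbb{Z}^2$ to the simplicial complex whose simplices are the nonempty $A\subseteq\{x_i:i\le a\}$ with $d_X^{\mathbb{Z}}(y,y')\le b$ for all $y,y'\in A$ (empty if $b<0$), with inclusions as internal maps. $\mathrm{H}_0$ has coefficients in a fixed field $\mathbb{F}$. **Graded Betti numbers.** $\mathbb{Z}^2$ has the product order. For $\mathbf{a}\in\mathbb{Z}^2$, $Q^{\mathbf{a}}:\mathbb{Z}^2\to\mathbf{Vec}$ is $\mathbb{F}$ at $\mathbf{x}\ge\mathbf{a}$ with identity maps, and $0$ elsewhere; a module is free if it is isomorphic to a direct sum $\bigoplus_{\mathbf{a}\in\mathcal{A}}Q^{\mathbf{a}}$ ($\mathcal{A}$ a multiset), and the number of elements of grade $\mathbf{a}$ in any basis is the multiplicity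 of $\mathbf{a}$ in $\mathcal{A}$. For a module $N$, $IN$ is the submodule generated by images of all internal maps $N_{\mathbf{a}}\to N_{\mathbf{b}}$, $\mathbf{a}<\mathbf{b}$. A minimal free resolution of $M$ is an exact sequence $\cdots\to F^2\xrightarrow{\partial_2}F^1\xrightarrow{\partial_1}F^0\to M\to0$ with every $F^i$ free and $\mathrm{im}(\partial_i)\subseteq IF^{i-1}$ for $i\ge1$; it is unique up to isomorphism. $\beta_i^M(\mathbf{a})$ is the number of elements of grade $\mathbf{a}$ in any basis of $F^i$. **Elder-rule feature functions.** For $(\sigma,\varepsilon)\in\mathbb{R}^2$ with $\varepsilon\ge0$ and $x$ with $f_X^{\mathbb{Z}}(x)\le\sigma$, let $[x]_{(\sigma,\varepsilon)}$ be the set of points joined to $x$ by a sequence in $\{y:f_X^{\mathbb{Z}}(y)\le\sigma\}$ with consecutive $d_X^{\mathbb{Z}}$-values $\le\varepsilon$. Let $I_x$ be the set of $(\sigma,\varepsilon)$, $\varepsilon\ge0$, $f^{\mathbb{Z}}_X(x)\le\sigma$, such that $x$ has the smallest $f_X^{\mathbb{Z}}$-value in $[x]_{(\sigma,\varepsilon)}$. For $I=I_x$ and $\mathbf{a}\in\mathbb{R}^2$ let $l=\lim_{t\to0+}\mathbf{1}_I(\mathbf{a}-(t,0))$, $b=\lim_{t\to0+}\mathbf{1}_I(\mathbf{a}-(0,t))$, $d=\lim_{t\to0+}\mathbf{1}_I(\mathbf{a}-(t,t))$. Then $\mathbf{a}$ is a $0$-th type corner point of $I$ if $\mathbf{1}_I(\mathbf{a})=1$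 and $l=b=d=0$; a $1$-st type corner point if $\mathbf{1}_I(\mathbf{a})-l-b+d=-1$; a $2$-nd type corner point if $\mathbf{1}_I(\mathbf{a})=0$, $l=b=0$, $d=1$. $\gamma_j^{\mathcal{X}}(\mathbf{a})$ is the number of $x\in X$ such that $\mathbf{a}$ is a $j$-th type corner point of $I_x$. *)

(* Defs.v *)
From HB Require Import structures.
From mathcomp Require Import all_boot all_order all_algebra.
From mathcomp Require Import generic_quotient ring_quotient.
From mathcomp Require Import all_classical all_reals all_analysis.

Set Implicit Arguments.
Unset Strict Implicit.
Unset Printing Implicit Defensive.

Import Order.TTheory GRing.Theory Num.Theory.
Import numFieldNormedType.Exports.

Local Open Scope ring_scope.

Definition mk_linear (F : fieldType) (U V : lmodType F) (f : U -> V)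
    (fL : linear f) : {linear U -> V} :=
  HB.pack f (GRing.isLinear.Build F U V *:%R f fL).

Section VectorQuotient.
Variables (F : fieldType) (V : vectType F) (U : {vspace V}).
Local Open Scope quotient_scope.

Definition vquot := Quotient.quot U.

HB.instance Definition _ := GRing.Zmodule.on vquot.

Definition vquot_pi (v : V) : vquot := \pi_(Quotient.quot U) v.
Definition vquot_repr (q : vquot) : V := repr (q : Quotient.quot U).
Definition vquot_scale (k : F) (q : vquot) : vquot :=
  vquot_pi (k *: vquot_repr q).

Lemma vquot_reprK : cancel vquot_repr vquot_pi.
Proof. exact: reprK. Qed.

Lemma vquot_piP (u v : V) : vquot_pi u = vquot_pi v <-> u - v \in U.
Proof.
split=> [h|h]; first by rewrite Quotient.idealrBE; apply/eqP.
by apply/eqP; rewrite -Quotient.idealrBE.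
Qed.

Lemma vquot_piD : {morph vquot_pi : u v / u + v}.
Proof. exact: (raddfD (\pi_(Quotient.quot U))). Qed.

Lemma vquot_scaleE k v : vquot_scale k (vquot_pi v) = vquot_pi (k *: v).
Proof.
apply/vquot_piP; rewrite -scalerBr memvZ //.
by apply/vquot_piP; rewrite vquot_reprK.
Qed.

Lemma vquot_scaleA a b v :
  vquot_scale a (vquot_scale b v) = vquot_scale (a * b) v.
Proof. by rewrite -[v]vquot_reprK !vquot_scaleE scalerA. Qed.
Lemma vquot_scale1 : left_id 1 vquot_scale.
Proof. by move=> v; rewrite -[v]vquot_reprK vquot_scaleE scale1r. Qed.
Lemma vquot_scaleDr : right_distributive vquot_scale +%R.
Proof.
move=> a u v; rewrite -[u]vquot_reprK -[v]vquot_reprK.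
by rewrite -vquot_piD !vquot_scaleE scalerDr vquot_piD.
Qed.
Lemma vquot_scaleDl v : {morph vquot_scale^~ v : a b / a + b}.
Proof.
by move=> a b; rewrite -[v]vquot_reprK !vquot_scaleE scalerDl vquot_piD.
Qed.

HB.instance Definition _ := GRing.Zmodule_isLmodule.Build F vquot
  vquot_scaleA vquot_scale1 vquot_scaleDr vquot_scaleDl.

Lemma vquot_pi_linear : linear vquot_pi.
Proof. by move=> k u v; rewrite vquot_piD -vquot_scaleE. Qed.

End VectorQuotient.

Section VectorQuotientMap.
Variables (F : fieldType) (V1 V2 : vectType F).
Variables (U1 : {vspace V1}) (U2 : {vspace V2}) (f : {linear V1 -> V2}).
Hypothesis fU : forall u, u \in U1 -> f u \in U2.

Definition vquot_map_fun (q : vquot U1) : vquot U2 :=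
  vquot_pi U2 (f (vquot_repr q)).

Lemma vquot_map_funE v : vquot_map_fun (vquot_pi U1 v) = vquot_pi U2 (f v).
Proof.
apply/vquot_piP; rewrite -linearB; apply: fU.
by apply/vquot_piP; rewrite vquot_reprK.
Qed.

Lemma vquot_map_linear : linear vquot_map_fun.
Proof.
move=> k u v; rewrite -[u]vquot_reprK -[v]vquot_reprK.
by rewrite -vquot_pi_linear !vquot_map_funE linearP vquot_pi_linear.
Qed.

Definition vquot_map : {linear vquot U1 -> vquot U2} :=
  mk_linear vquot_map_linear.

Lemma vquot_mapE v : vquot_map (vquot_pi U1 v) = vquot_pi U2 (f v).
Proof. exact: vquot_map_funE. Qed.

End VectorQuotientMap.

(* [*p] carries the product order. *)
Notation Z2 := (int *p int)%type.

Record pmod (F : fieldType) := PMod {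
  pm_obj :> Z2 -> lmodType F;
  pm_map : forall a b : Z2, (a <= b)%O -> {linear pm_obj a -> pm_obj b};
  pm_map_id : forall (a : Z2) (h : (a <= a)%O) v, pm_map h v = v;
  pm_map_comp : forall (a b c : Z2) (h1 : (a <= b)%O) (h2 : (b <= c)%O)
    (h3 : (a <= c)%O) v, pm_map h2 (pm_map h1 v) = pm_map h3 v }.

Record pm_hom (F : fieldType) (M N : pmod F) := PMHom {
  pm_fun :> forall a : Z2, {linear M a -> N a};
  pm_nat : forall (a b : Z2) (h : (a <= b)%O) v,
    pm_fun b (pm_map M h v) = pm_map N h (pm_fun a v) }.

Definition pm_isomorphic (F : fieldType) (M N : pmod F) : Prop :=
  exists (f : pm_hom M N) (g : pm_hom N M),
    forall a : Z2, cancel (f a) (g a) /\ cancel (g a) (f a).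

Section Submodules.
Variables (F : fieldType) (N : pmod F).

Definition is_submodule (S : forall a : Z2, N a -> Prop) : Prop :=
  [/\ forall a, S a 0,
      forall a k u v, S a u -> S a v -> S a (k *: u + v) &
      forall (a b : Z2) (h : (a <= b)%O) v, S a v -> S b (pm_map N h v)].

(* IN, the submodule generated by the images of the internal maps from a to b
   with a < b. *)
Definition in_IN (x : Z2) (v : N x) : Prop :=
  forall S : (forall a : Z2, N a -> Prop), is_submodule S ->
    (forall (a b : Z2) (h : (a < b)%O) (u : N a), S b (pm_map N (ltW h) u)) ->
    S x v.

End Submodules.

Section ElementaryFree.
Variables (F : fieldType) (a : Z2).

Definition Q_space (x : Z2) : {vspace F^o} :=
  if (a <= x)%O then fullv else 0%VS.

Definition Q_obj (x : Z2) : lmodType F := subvs_of (Q_space x).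

Lemma Q_space_sub x y : (x <= y)%O -> (Q_space x <= Q_space y)%VS.
Proof.
rewrite /Q_space; case: ifP => [ax xy|_ _]; last exact: sub0v.
by rewrite (le_trans ax xy).
Qed.

(* Since Q_space x is contained in Q_space y, vsproj leaves the scalar
   unchanged, see Q_mapE. *)
Definition Q_map (x y : Z2) (h : (x <= y)%O) : {linear Q_obj x -> Q_obj y} :=
  (vsproj (Q_space y) \o vsval)%FUN.

Lemma Q_mapE x y (h : (x <= y)%O) v : vsval (Q_map h v) = vsval v.
Proof. by rewrite /= vsprojK //; apply: (subvP (Q_space_sub h)); exact: subvsP. Qed.

Lemma Q_map_id x (h : (x <= x)%O) v : Q_map h v = v.
Proof. by apply: val_inj; exact: Q_mapE. Qed.

Lemma Q_map_comp x y z (h1 : (x <= y)%O) (h2 : (y <= z)%O) (h3 : (x <= z)%O) v :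
  Q_map h2 (Q_map h1 v) = Q_map h3 v.
Proof. by apply: val_inj; rewrite [LHS]Q_mapE [RHS]Q_mapE Q_mapE. Qed.

Definition Q_mod : pmod F := PMod Q_map_id Q_map_comp.

End ElementaryFree.

Section DirectProductSpace.
Variables (F : fieldType) (I : Type) (V : I -> lmodType F).

Definition dprod := forall i, V i.

HB.instance Definition _ := gen_eqMixin dprod.
HB.instance Definition _ := gen_choiceMixin dprod.

Definition dprod_add (u v : dprod) : dprod := fun i => u i + v i.
Definition dprod_opp (u : dprod) : dprod := fun i => - u i.
Definition dprod_scale (k : F) (u : dprod) : dprod := fun i => k *: u i.

Lemma dprod_addA : associative dprod_add.
Proof. by move=> u v w; apply: functional_extensionality_dep => i; exact: addrA. Qed.
Lemma dprod_addC : commutative dprod_add.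
Proof. by move=> u v; apply: functional_extensionality_dep => i; exact: addrC. Qed.
Lemma dprod_add0 : left_id (fun i => 0) dprod_add.
Proof. by move=> u; apply: functional_extensionality_dep => i; exact: add0r. Qed.
Lemma dprod_addN : left_inverse (fun i => 0) dprod_opp dprod_add.
Proof. by move=> u; apply: functional_extensionality_dep => i; exact: addNr. Qed.

HB.instance Definition _ := GRing.isZmodule.Build dprod
  dprod_addA dprod_addC dprod_add0 dprod_addN.

Lemma dprod_scaleA a b v : dprod_scale a (dprod_scale b v) = dprod_scale (a * b) v.
Proof. by apply: functional_extensionality_dep => i; exact: scalerA. Qed.
Lemma dprod_scale1 : left_id 1 dprod_scale.
Proof. by move=> v; apply: functional_extensionality_dep => i; exact: scale1r. Qed.
Lemma dprod_scaleDr : right_distributive dprod_scale +%R.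
Proof. by move=> a u v; apply: functional_extensionality_dep => i; exact: scalerDr. Qed.
Lemma dprod_scaleDl v : {morph dprod_scale^~ v : a b / a + b}.
Proof. by move=> a b; apply: functional_extensionality_dep => i; exact: scalerDl. Qed.

HB.instance Definition _ := GRing.Zmodule_isLmodule.Build F dprod
  dprod_scaleA dprod_scale1 dprod_scaleDr dprod_scaleDl.

Definition fin_supp : pred dprod :=
  fun u => `[< finite_set [set i | u i <> 0]%classic >].

Lemma fin_supp_submod : submod_closed fin_supp.
Proof.
split; first by apply/asboolP; apply: (sub_finite_set _ (finite_set0 I)) => i; exact.
move=> k u v /asboolP fu /asboolP fv; apply/asboolP.
apply: (@sub_finite_set _ _ ([set i | u i <> 0] `|` [set i | v i <> 0])%classic).
  move=> i /= uvi; apply: contrapT => /not_orP[/contrapT ui /contrapT vi].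
  by apply: uvi; change (k *: u i + v i = 0); rewrite ui vi scaler0 addr0.
by rewrite finite_setU.
Qed.

HB.instance Definition _ := GRing.isSubmodClosed.Build F dprod fin_supp
  fin_supp_submod.

Definition dsum_obj := {u : dprod | u \in fin_supp}.
HB.instance Definition _ := SubChoice.on dsum_obj.
HB.instance Definition _ := [SubChoice_isSubLmodule of dsum_obj by <:].

End DirectProductSpace.

Section DirectSum.
Variables (F : fieldType) (I : Type) (N : I -> pmod F).

Definition dsum_space (x : Z2) : lmodType F := dsum_obj (fun i => N i x).

Section Map.
Variables (x y : Z2) (h : (x <= y)%O).

Definition dsum_map_dprod (u : dprod (fun i => N i x)) :
  dprod (fun i => N i y) := fun i => pm_map (N i) h (u i).

Lemma dsum_map_subproof (u : dsum_space x) :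
  dsum_map_dprod (val u) \in @fin_supp F I (fun i => N i y).
Proof.
case: u => u /= /asboolP fu; apply/asboolP.
by apply: (sub_finite_set _ fu) => i /= ui ui0; apply: ui;
  rewrite /dsum_map_dprod ui0 linear0.
Qed.

Definition dsum_map_fun (u : dsum_space x) : dsum_space y :=
  exist _ (dsum_map_dprod (val u)) (dsum_map_subproof u).

Lemma dsum_map_linear : linear dsum_map_fun.
Proof.
move=> k u v; apply: val_inj; apply: functional_extensionality_dep => i.
exact: linearP.
Qed.

Definition dsum_map : {linear dsum_space x -> dsum_space y} :=
  mk_linear dsum_map_linear.

End Map.

Lemma dsum_map_id x (h : (x <= x)%O) v : dsum_map h v = v.
Proof.
apply: val_inj; apply: functional_extensionality_dep => i.
exact: pm_map_id.
Qed.

Lemma dsum_map_comp x y z (h1 : (x <= y)%O) (h2 : (y <= z)%O) (h3 : (x <= z)%O) v :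
  dsum_map h2 (dsum_map h1 v) = dsum_map h3 v.
Proof.
apply: val_inj; apply: functional_extensionality_dep => i.
exact: pm_map_comp.
Qed.

Definition dsum : pmod F := PMod dsum_map_id dsum_map_comp.

End DirectSum.

Section Betti.
Variable F : fieldType.

(* N is the direct sum of the Q^{g i}: the family g is the multiset of grades
   of a basis of N. *)
Definition free_on (N : pmod F) (I : Type) (g : I -> Z2) : Prop :=
  pm_isomorphic N (dsum (fun i => Q_mod F (g i))).

Definition is_free (N : pmod F) : Prop :=
  exists (I : Type) (g : I -> Z2), free_on N g.

(* [res_d r i] is the differential from degree i.+1 to degree i. *)
Record res_data (M : pmod F) := ResData {
  res_mod :> nat -> pmod F;
  res_d : forall i, pm_hom (res_mod i.+1) (res_mod i);
  res_aug : pm_hom (res_mod 0%N) M }.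

Definition is_minimal_free_resolution (M : pmod F) (r : res_data M) : Prop :=
  [/\ forall i, is_free (r i),
      forall (a : Z2) (m : M a), exists v, res_aug r a v = m,
      forall (a : Z2) (v : r 0%N a),
        res_aug r a v = 0 <-> exists w, res_d r 0%N a w = v,
      forall i (a : Z2) (v : r i.+1 a),
        res_d r i a v = 0 <-> exists w, res_d r i.+1 a w = v &
      forall i (a : Z2) (w : r i.+1 a), in_IN (res_d r i a w)].

(* "The i-th graded Betti number of M at a is n": M has a minimal free
   resolution, and in every one of them every basis of the i-th module has
   exactly n elements of grade a. *)
Definition is_graded_betti (M : pmod F) (i : nat) (a : Z2) (n : nat) : Prop :=
  (exists r : res_data M, is_minimal_free_resolution r) /\
  (forall r : res_data M, is_minimal_free_resolution r ->
   forall (I : Type) (g : I -> Z2), free_on (r i) g ->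
     ([set j | g j = a] #= `I_n)%classic%card).

End Betti.

Record complex (V : finType) := Complex {
  simplices :> {set {set V}};
  simplex_neq0 : finset.set0 \notin simplices;
  simplex_face : forall A B : {set V}, A \in simplices ->
    B \subset A -> B != finset.set0 -> B \in simplices }.

Record filtration (V : finType) := Filtration {
  filt_cx :> Z2 -> complex V;
  filt_inc : forall a b : Z2, (a <= b)%O -> filt_cx a \subset filt_cx b }.

Section ZerothHomology.
Variables (F : fieldType) (V : finType).

Definition vertex_chain (x : V) : {ffun V -> F^o} := [ffun y => (y == x)%:R].

Definition chains0 (K : complex V) : {vspace {ffun V -> F^o}} :=
  <<[seq vertex_chain x | x <- enum V & [set x]%SET \in simplices K]>>%VS.

(* The image of the boundary map, which is spanned by the boundaries of the
   edges of K. *)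
Definition boundaries0 (K : complex V) : {vspace subvs_of (chains0 K)} :=
  <<[seq vsproj (chains0 K) (vertex_chain e.2 - vertex_chain e.1)
    | e <- enum (@predT (V * V)%type)
    & (e.1 != e.2) && ([set e.1; e.2]%SET \in simplices K)]>>%VS.

Definition H0_space (K : complex V) : lmodType F := vquot (boundaries0 K).

Section Induced.
Variables (K L : complex V) (KL : K \subset L).

Definition chains0_map :
    {linear subvs_of (chains0 K) -> subvs_of (chains0 L)} :=
  (vsproj (chains0 L) \o vsval)%FUN.

Lemma chains0_sub : (chains0 K <= chains0 L)%VS.
Proof.
apply: sub_span => c /mapP[x]; rewrite mem_filter => /andP[xK xV] ->.
by apply: map_f; rewrite mem_filter xV (fintype.subsetP KL _ xK).
Qed.

Lemma chains0_mapE c : vsval (chains0_map c) = vsval c.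
Proof. by rewrite /= vsprojK //; apply: (subvP chains0_sub); exact: subvsP. Qed.

Lemma vertex_chain_in (M : complex V) (e : V * V) :
  [set e.1; e.2]%SET \in simplices M ->
  vertex_chain e.2 - vertex_chain e.1 \in chains0 M.
Proof.
move=> eM; have vM x : x \in [set e.1; e.2]%SET -> vertex_chain x \in chains0 M.
  move=> xe; apply: memv_span; apply: map_f.
  rewrite mem_filter mem_enum andbT; apply: (simplex_face eM).
    by rewrite finset.sub1set.
  by apply/finset.set0Pn; exists x; rewrite inE.
by rewrite rpredB // vM // !inE eqxx ?orbT.
Qed.

Lemma boundaries0_map c : c \in boundaries0 K -> chains0_map c \in boundaries0 L.
Proof.
rewrite -(lfunE chains0_map) => cB.
have : linfun chains0_map c \in (linfun chains0_map @: boundaries0 K)%VS.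
  exact: memv_img.
apply: subvP; rewrite limg_span; apply/span_subvP => _ /mapP[_ /mapP[e + ->] ->].
rewrite mem_filter => /andP[/andP[ne eK] _]; rewrite lfunE.
have eL : [set e.1; e.2]%SET \in simplices L by exact: (fintype.subsetP KL).
apply: memv_span; apply/mapP; exists e.
  by rewrite mem_filter ne eL mem_enum.
apply: val_inj; rewrite [LHS]chains0_mapE.
by rewrite /= !vsprojK // vertex_chain_in.
Qed.

Definition H0_map : {linear H0_space K -> H0_space L} :=
  vquot_map boundaries0_map.

End Induced.

Variable K : filtration V.

Definition H0_obj (a : Z2) : lmodType F := H0_space (K a).
Definition H0_tr (a b : Z2) (h : (a <= b)%O) : {linear H0_obj a -> H0_obj b} :=
  H0_map (filt_inc K h).

Lemma H0_tr_id a (h : (a <= a)%O) v : H0_tr h v = v.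
Proof.
rewrite -[v]vquot_reprK [LHS]vquot_mapE; congr vquot_pi.
by apply: val_inj; exact: (chains0_mapE (filt_inc K h)).
Qed.

Lemma H0_tr_comp a b c (h1 : (a <= b)%O) (h2 : (b <= c)%O) (h3 : (a <= c)%O) v :
  H0_tr h2 (H0_tr h1 v) = H0_tr h3 v.
Proof.
rewrite -[v]vquot_reprK [H0_tr h1 _]vquot_mapE [LHS]vquot_mapE [RHS]vquot_mapE.
congr vquot_pi; apply: val_inj.
rewrite [LHS](chains0_mapE (filt_inc K h2)) [RHS](chains0_mapE (filt_inc K h3)).
exact: (chains0_mapE (filt_inc K h1)).
Qed.

Definition H0 : pmod F := PMod H0_tr_id H0_tr_comp.

End ZerothHomology.

#[short(type="finMetricType")]
HB.structure Definition FinMetric (R : numDomainType) :=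
  { X of Finite X & Metric R X }.

Section Augmented.
Variables (R : realType) (X : finMetricType R) (f : X -> R).

Definition generic : Prop :=
  injective f /\
  forall x y x' y' : X, x != y -> x' != y' -> mdist x y = mdist x' y' ->
    [set x; y]%SET = [set x'; y']%SET.

(* f^Z x is the position, counted from 1, of f x in the increasing list of the
   values of f, and d^Z x y that of d x y in the increasing list of the
   distances between distinct points. *)
Definition fZ (x : X) : nat :=
  (index (f x) (sort <=%R (undup [seq f y | y : X]))).+1.

Definition nonzero_distances : seq R :=
  sort <=%R (undup [seq mdist p.1 p.2 | p : (X * X)%type in [pred q | q.1 != q.2]]).

Definition dZ (x y : X) : nat :=
  if x == y then 0%N else (index (mdist x y) nonzero_distances).+1.

Definition rips_simplices (a : Z2) : {set {set X}} :=
  [set A : {set X} | [&& A != finset.set0,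
     [forall y in A, (fZ y)%:Z <= a.1] &
     [forall y in A, forall y' in A, (dZ y y')%:Z <= a.2]]]%SET.

Lemma rips_neq0 a : finset.set0 \notin rips_simplices a.
Proof. by rewrite inE eqxx. Qed.

Lemma rips_face a (A B : {set X}) : A \in rips_simplices a ->
  B \subset A -> B != finset.set0 -> B \in rips_simplices a.
Proof.
rewrite !inE => /and3P[_ /forall_inP hf /forall_inP hd] /fintype.subsetP BA -> /=.
apply/andP; split; apply/forall_inP => y /BA yA; first exact: hf.
by apply/forall_inP => y' /BA y'A; exact: (forall_inP (hd y yA)).
Qed.

Lemma rips_inc (a b : Z2) : (a <= b)%O ->
  rips_simplices a \subset rips_simplices b.
Proof.
move=> /andP[ab1 ab2]; apply/fintype.subsetP => A.
rewrite !inE => /and3P[-> /forall_inP hf /forall_inP hd] /=.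
apply/andP; split; apply/forall_inP => y yA; first exact: le_trans (hf y yA) ab1.
by apply/forall_inP => y' y'A; exact: le_trans (forall_inP (hd y yA) _ y'A) ab2.
Qed.

Definition rips : filtration X :=
  @Filtration X (fun a => Complex (rips_neq0 a) (@rips_face a)) rips_inc.

Definition elder_class (s e : R) (x : X) : {set X} :=
  [set y | connect [rel z z' | [&& (fZ z)%:R <= s, (fZ z')%:R <= s
                                 & (dZ z z')%:R <= e]] x y]%SET.

Definition elder_region (x : X) : set (R * R) :=
  [set p | [/\ 0 <= p.2, (fZ x)%:R <= p.1 &
     forall y, y \in elder_class p.1 p.2 x -> (fZ x <= fZ y)%N]]%classic.

End Augmented.

Section Corners.
Variable R : realType.
Local Open Scope classical_set_scope.

(* [lim] is a total operator, with an arbitrary value where the limit does not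
   exist; for the elder regions, which are finite unions of products of
   half-open intervals, the limits below exist. *)
Definition indic_lim (J : set (R * R)) (a : R * R) (u v : R) : R :=
  lim ((\1_J (a.1 - t * u, a.2 - t * v) : R) @[t --> (0 : R)^'+]).

Definition is_corner (j : nat) (J : set (R * R)) (a : R * R) : Prop :=
  let l := indic_lim J a 1 0 in
  let b := indic_lim J a 0 1 in
  let d := indic_lim J a 1 1 in
  match j with
  | 0 => [/\ \1_J a = 1 :> R, l = 0, b = 0 & d = 0]
  | 1 => \1_J a - l - b + d = -1
  | 2 => [/\ \1_J a = 0 :> R, l = 0, b = 0 & d = 1]
  | _ => False
  end.

End Corners.

(* [a] ranges over Z^2 rather than R^2: this is the restricted function. *)
Definition elder_feature (R : realType) (X : finMetricType R) (f : X -> R)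
    (j : nat) (a : Z2) : nat :=
  #|[set x : X | `[< is_corner j (elder_region f x) (a.1%:~R, a.2%:~R) >]]%SET|.

(* Main.v *)
Require Import Defs.
From HB Require Import structures.
From mathcomp Require Import all_boot all_order all_algebra.
From mathcomp Require Import all_classical all_reals all_analysis.
From mathcomp Require Import zify.

(* For [i <= 2], a minimal free resolution identifies [F^i / I F^i] at [a] with
   the degree [i] Koszul homology of [M] at [a], so Betti numbers can be read off
   any one minimal free resolution.

   For [H_0] of the Rips filtration one takes [F^0] on the vertices, [F^1] on the
   essential edges, those whose boundary is not already a combination of
   boundaries of shorter edges between vertices no later, and [F^2] the kernel
   of [F^1 -> F^0]. As distinct edges have distinct lengths, [F^2] has a
   triangular basis: the essential edge [e] contributes one element, in the row
   of [e], at the first column where the boundary of [e] becomes a combination of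
   boundaries of shorter edges. That column is to the right of [e], and a row
   holds at most one edge, so [beta_1] and [beta_2] have disjoint supports.

   The dimension of [M] at [a] is the number of components, that is, of points
   [x] with [a] in the elder region of [x]. The second difference in [a] of this
   number is [beta_0 - beta_1 + beta_2] by the resolution, and is
   [gamma_0 - gamma_1 + gamma_2] by inspection of the corners of each region.
   Since [beta_0 = gamma_0], disjointness of the supports gives the truncated
   differences. *)

Set Implicit Arguments.
Unset Strict Implicit.
Unset Printing Implicit Defensive.

Import Order.TTheory GRing.Theory Num.Theory.
Import numFieldNormedType.Exports.

Local Open Scope ring_scope.

(** * Persistence modules over the integer plane *)

Definition west (a : Z2) : Z2 := (a.1 - 1, a.2).
Definition south (a : Z2) : Z2 := (a.1, a.2 - 1).
Definition southwest (a : Z2) : Z2 := (a.1 - 1, a.2 - 1).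

Lemma leZ2 (a b : Z2) : (a <= b)%O = (a.1 <= b.1) && (a.2 <= b.2).
Proof. by []. Qed.

Lemma west_le a : (west a <= a)%O. Proof. rewrite leZ2 /=; lia. Qed.
Lemma south_le a : (south a <= a)%O. Proof. rewrite leZ2 /=; lia. Qed.
Lemma southwest_le a : (southwest a <= a)%O. Proof. rewrite leZ2 /=; lia. Qed.
Lemma southwest_west a : (southwest a <= west a)%O. Proof. rewrite leZ2 /=; lia. Qed.
Lemma southwest_south a : (southwest a <= south a)%O. Proof. rewrite leZ2 /=; lia. Qed.

Lemma west_mono (a b : Z2) : (a <= b)%O -> (west a <= west b)%O.
Proof. rewrite !leZ2 /=; lia. Qed.
Lemma south_mono (a b : Z2) : (a <= b)%O -> (south a <= south b)%O.
Proof. rewrite !leZ2 /=; lia. Qed.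

Lemma Z2_eqE (a b : Z2) : (a == b) = (a.1 == b.1) && (a.2 == b.2).
Proof. by []. Qed.

Lemma lt_west_south (a b : Z2) :
  (a <= b)%O -> a != b -> (a <= west b)%O \/ (a <= south b)%O.
Proof.
rewrite Z2_eqE !leZ2 /= => ab nab.
by apply/orP; move: ab nab; lia.
Qed.

Lemma le_west_south (a b : Z2) :
  (a <= west b)%O -> (a <= south b)%O -> (a <= southwest b)%O.
Proof. rewrite !leZ2 /=; lia. Qed.

Section ImageSubmodule.
Variables (F : fieldType) (N : pmod F).

Lemma pm_map_irr (a b : Z2) (h h' : (a <= b)%O) (v : N a) :
  pm_map N h v = pm_map N h' v.
Proof. by rewrite (bool_irrelevance h h'). Qed.

(** Any strict step up to [a] passes through [west a] or [south a], so two internal maps suffice to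
    describe [IN] at [a]. These two maps are the ones of the Koszul complex below. *)
Lemma in_INP (a : Z2) (v : N a) :
  in_IN v <-> exists (v1 : N (west a)) (v2 : N (south a)),
    v = pm_map N (west_le a) v1 + pm_map N (south_le a) v2.
Proof.
pose S b (u : N b) := exists (v1 : N (west b)) (v2 : N (south b)),
    u = pm_map N (west_le b) v1 + pm_map N (south_le b) v2.
(* As [in_IN] quantifies over all submodules, the forward direction instantiates it at [S]; what
   remains is that [S] is a submodule containing the images. *)
split=> [|[v1 [v2 ->]] T [T0 TL TM] TI].
  apply: (_ : in_IN v -> S a v); apply.
    split.
    - by move=> b; exists 0, 0; rewrite !linear0 addr0.
    - move=> b k u w [u1 [u2 ->]] [w1 [w2 ->]].
      exists (k *: u1 + w1), (k *: u2 + w2).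
      by rewrite !linearP scalerDr addrACA.
    - move=> b c h u [u1 [u2 ->]].
      exists (pm_map N (west_mono h) u1), (pm_map N (south_mono h) u2).
      have hl : (west b <= c)%O := le_trans (west_le b) h.
      have hd : (south b <= c)%O := le_trans (south_le b) h.
      by rewrite linearD !(pm_map_comp _ _ hl) !(pm_map_comp _ _ hd).
  move=> b c h u; have [hl|hd] := lt_west_south (ltW h) (negbT (lt_eqF h)).
    exists (pm_map N hl u), 0; rewrite linear0 addr0.
    by rewrite (pm_map_comp _ _ (ltW h)).
  exists 0, (pm_map N hd u); rewrite linear0 add0r.
  by rewrite (pm_map_comp _ _ (ltW h)).
have TD b (u w : N b) : T b u -> T b w -> T b (u + w).
  by move=> Tu Tw; rewrite -[u]scale1r; apply: TL.
have hl : (west a < a)%O by rewrite lt_neqAle west_le Z2_eqE /= andbT; lia.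
have hd : (south a < a)%O by rewrite lt_neqAle south_le Z2_eqE /= andbT; lia.
by apply: TD; [move: (TI _ _ hl v1)|move: (TI _ _ hd v2)];
  rewrite (pm_map_irr _ (west_le a), pm_map_irr _ (south_le a)).
Qed.

End ImageSubmodule.

(** * Free modules through coordinates *)

Section ElementaryValues.
Variables (F : fieldType) (a x : Z2).

Definition Q_val (q : Q_mod F a x) : F := @vsval F F^o (Q_space F a x) q.
Definition Q_mk (k : F) : Q_mod F a x := vsproj (Q_space F a x) (k : F^o).

Lemma Q_val_inj : injective Q_val.
Proof. exact: val_inj. Qed.

Lemma Q_valP k u v : Q_val (k *: u + v) = k * Q_val u + Q_val v.
Proof. by []. Qed.

Lemma Q_val0 : Q_val 0 = 0.
Proof. by []. Qed.

Lemma Q_val_supp q : Q_val q <> 0 -> (a <= x)%O.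
Proof.
move=> q0; apply: contrapT => /negP/negbTE ax; apply: q0.
have : Q_space F a x = 0%VS by rewrite /Q_space ax.
have := @subvsP F F^o (Q_space F a x) q; rewrite -/(Q_val q) => + Q0.
by rewrite [in X in X -> _]Q0 memv0 => /eqP.
Qed.

(** Outside the support of [Q_mod F a] the space is zero and the projection kills [k]; the
    hypothesis allows only [k = 0] there. *)
Lemma Q_mkK k : (k <> 0 -> (a <= x)%O) -> Q_val (Q_mk k) = k.
Proof.
move=> ka; rewrite /Q_val /Q_mk; apply: (@vsprojK F F^o (Q_space F a x) (k : F^o)).
rewrite /Q_space; case: ifPn => ax; rewrite ?memvf //.
by rewrite memv0; apply/eqP; apply: contrapT => /ka; rewrite (negbTE ax).
Qed.

End ElementaryValues.

Section Coordinates.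
Variables (F : fieldType) (N : pmod F) (I : Type) (g : I -> Z2).

(** An isomorphism with a direct sum of the [Q_mod F (g i)], written with plain scalar functions to
    avoid dependent products. Internal maps of each summand are identities, hence [co_nat] keeps the
    coordinates unchanged. *)
Record is_coords (c : forall x, N x -> I -> F) : Prop := IsCoords {
  co_lin : forall x k (u v : N x) i, c x (k *: u + v) i = k * c x u i + c x v i;
  co_nat : forall x y (h : (x <= y)%O) (v : N x) i, c y (pm_map N h v) i = c x v i;
  co_supp : forall x (v : N x) i, c x v i <> 0 -> (g i <= x)%O;
  co_fin : forall x (v : N x), finite_set [set i | c x v i <> 0]%classic;
  co_inj : forall x (v : N x), (forall i, c x v i = 0) -> v = 0;
  co_surj : forall x (u : I -> F), (forall i, u i <> 0 -> (g i <= x)%O) ->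
    finite_set [set i | u i <> 0]%classic ->
    exists v : N x, forall i, c x v i = u i }.

Lemma free_on_coords : free_on N g -> exists c, is_coords c.
Proof.
case=> f [f' fK]; exists (fun x v i => Q_val (val (f x v) i)); split.
- by move=> x k u v i; rewrite linearP; exact: Q_valP.
- move=> x y h v i; rewrite pm_nat.
  exact: (Q_mapE h (val (f x v) i)).
- by move=> x v i; exact: Q_val_supp.
- move=> x v; case: (f x v) => u /= /asboolP fu.
  apply: sub_finite_set fu => i /= ui ui0; apply: ui.
  by rewrite ui0 Q_val0.
- move=> x v v0; rewrite -[v](fK x).1; set u := f x v.
  suff -> : u = 0 by rewrite linear0.
  by apply: val_inj; apply: functional_extensionality_dep => i; apply: Q_val_inj; exact: v0.
- move=> x u ug ufin.
  pose w : dprod (fun i => Q_mod F (g i) x) := fun i => Q_mk (g i) x (u i).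
  have wE i : Q_val (w i) = u i by apply: Q_mkK; exact: ug.
  have wfin : w \in @fin_supp F I (fun i => Q_mod F (g i) x).
    apply/asboolP; apply: sub_finite_set ufin => i /= wi ui; apply: wi.
    by apply: Q_val_inj; rewrite wE.
  exists (f' x (exist _ w wfin)) => i.
  by rewrite (fK x).2; exact: wE.
Qed.

Lemma coords_free_on c : is_coords c -> free_on N g.
Proof.
move=> cc.
pose fu x (v : N x) : dprod (fun i => Q_mod F (g i) x) :=
  fun i => Q_mk (g i) x (c x v i).
have fuE x v i : Q_val (fu x v i) = c x v i by apply: Q_mkK; exact: (co_supp cc).
have ffin x v : fu x v \in @fin_supp F I (fun i => Q_mod F (g i) x).
  apply/asboolP; apply: sub_finite_set (co_fin cc v) => i /= wi ui; apply: wi.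
  by apply: Q_val_inj; rewrite fuE.
pose f x (v : N x) : dsum (fun i => Q_mod F (g i)) x := exist _ (fu x v) (ffin x v).
have fP x (u v : dsum (fun i => Q_mod F (g i)) x) :
  (forall i, Q_val (val u i) = Q_val (val v i)) -> u = v.
  move=> uv; apply: val_inj; apply: functional_extensionality_dep => i.
  exact: Q_val_inj.
have flin x : linear (f x).
  by move=> k u v; apply: fP => i; rewrite [LHS]fuE (co_lin cc) -!fuE; exact: Q_valP.
have fnat (x y : Z2) (h : (x <= y)%O) v :
  f y (pm_map N h v) = pm_map (dsum (fun i => Q_mod F (g i))) h (f x v).
  apply: fP => i; rewrite [LHS]fuE (co_nat cc).
  rewrite -fuE; symmetry; exact: (Q_mapE h).
have finj x (u v : N x) : f x u = f x v -> u = v.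
  move=> uv; apply/eqP; rewrite -subr_eq0; apply/eqP; apply: (co_inj cc) => i.
  rewrite addrC -scaleN1r (co_lin cc) -!fuE.
  have -> : fu x u i = fu x v i by move/(congr1 val): uv => /= ->.
  by rewrite mulN1r addNr.
have fsur x (u : dsum (fun i => Q_mod F (g i)) x) : exists v, f x v = u.
  have ufin : finite_set [set i | Q_val (val u i) <> 0]%classic.
    case: u => u /= /asboolP ufin.
    by apply: sub_finite_set ufin => i /= ui ui0; apply: ui; rewrite ui0 Q_val0.
  have usupp i : Q_val (val u i) <> 0 -> (g i <= x)%O by exact: Q_val_supp.
  have [v vE] := co_surj cc usupp ufin.
  by exists v; apply: fP => i; rewrite [LHS]fuE vE.
(* The inverse is obtained by choice; its linearity and naturality follow from those of [f] by
   injectivity. *)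
pose f' x u := projT1 (cid (fsur x u)).
have f'K x : cancel (f' x) (f x) by move=> u; exact: (projT2 (cid (fsur x u))).
have fK x : cancel (f x) (f' x) by move=> v; apply: finj; rewrite f'K.
have f'lin x : linear (f' x).
  by move=> k u v; apply: finj; rewrite flin !f'K.
exists (@PMHom F N (dsum (fun i => Q_mod F (g i))) (fun x => mk_linear (flin x)) fnat).
have f'nat (x y : Z2) (h : (x <= y)%O) v :
  f' y (pm_map (dsum (fun i => Q_mod F (g i))) h v) = pm_map N h (f' x v).
  by apply: finj; rewrite fnat !f'K.
exists (@PMHom F (dsum (fun i => Q_mod F (g i))) N (fun x => mk_linear (f'lin x)) f'nat).
by move=> x; split; [exact: fK|exact: f'K].
Qed.

End Coordinates.

Section CoordinateLemmas.
Variables (F : fieldType) (N : pmod F) (I : Type) (g : I -> Z2).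
Variables (c : forall x, N x -> I -> F) (cc : is_coords g c).
Arguments c {x}.

Lemma co_D x (u v : N x) i : c (u + v) i = c u i + c v i.
Proof. by rewrite -[u in LHS]scale1r (co_lin cc) mul1r. Qed.

Lemma co_0 x i : c (0 : N x) i = 0.
Proof. by apply: (addrI (c (0 : N x) i)); rewrite -co_D !addr0. Qed.

Lemma co_Z x k (v : N x) i : c (k *: v) i = k * c v i.
Proof. by rewrite -[k *: v]addr0 (co_lin cc) co_0 addr0. Qed.

Lemma co_sum x (J : Type) (s : seq J) (P : pred J) (f : J -> N x) i :
  c (\sum_(j <- s | P j) f j) i = \sum_(j <- s | P j) c (f j) i.
Proof. by elim/big_rec2: _ => [|j y z _ <-]; rewrite ?co_0 ?co_D. Qed.

Lemma co_eq x (u v : N x) : (forall i, c u i = c v i) -> u = v.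
Proof.
move=> uv; apply/eqP; rewrite -subr_eq0; apply/eqP; apply: (co_inj cc) => i.
by rewrite addrC -scaleN1r (co_lin cc) uv mulN1r addNr.
Qed.

Lemma free_map_inj x y (h : (x <= y)%O) : injective (pm_map N h).
Proof. by move=> u v uv; apply: co_eq => i; rewrite -!(co_nat cc h) uv. Qed.

(** A grade below both [west a] and [south a] is below [southwest a], so the common coordinates
    already define an element there. This is exactness of the Koszul complex of a free module in
    degree one. *)
Lemma free_pullback (a : Z2) (v1 : N (west a)) (v2 : N (south a)) :
  pm_map N (west_le a) v1 = pm_map N (south_le a) v2 ->
  exists w : N (southwest a),
    v1 = pm_map N (southwest_west a) w /\ v2 = pm_map N (southwest_south a) w.
Proof.
move=> v12; have cE i : c v1 i = c v2 i.
  by rewrite -(co_nat cc (west_le a)) v12 (co_nat cc).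
have supp i : c v1 i <> 0 -> (g i <= southwest a)%O.
  move=> c0; apply: le_west_south; first exact: (co_supp cc) c0.
  by move: c0; rewrite cE => /(co_supp cc).
have [w wE] := co_surj cc supp (co_fin cc v1).
by exists w; split; apply: co_eq => i; rewrite (co_nat cc) wE.
Qed.

(** Basis elements of grade other than [a] come from the west or the south, those of grade [a] from
    neither. The coordinates of grade [a] are thus coordinates on the quotient of [N a] by [IN]. *)
Lemma co_IN a (v : N a) : in_IN v <-> forall i, g i = a -> c v i = 0.
Proof.
split=> [/in_INP[v1 [v2 ->]] i gi|v0].
  rewrite co_D !(co_nat cc).
  have -> : c v1 i = 0.
    apply: contrapT => /(co_supp cc); rewrite gi leZ2 /=; lia.
  have -> : c v2 i = 0; last by rewrite addr0.
  by apply: contrapT => /(co_supp cc); rewrite gi leZ2 /=; lia.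
(* Whatever can come from the west is put there; the rest must come from the south. *)
pose u1 i := if (g i <= west a)%O then c v i else 0.
pose u2 i := if (g i <= west a)%O then 0 else c v i.
have u1c i : u1 i <> 0 -> c v i <> 0 by rewrite /u1; case: ifP.
have u2c i : u2 i <> 0 -> c v i <> 0 by rewrite /u2; case: ifP.
have f1 : finite_set [set i | u1 i <> 0]%classic.
  by apply: sub_finite_set (co_fin cc v) => i; exact: u1c.
have f2 : finite_set [set i | u2 i <> 0]%classic.
  by apply: sub_finite_set (co_fin cc v) => i; exact: u2c.
have s1 i : u1 i <> 0 -> (g i <= west a)%O by rewrite /u1; case: ifP.
have s2 i : u2 i <> 0 -> (g i <= south a)%O.
  move=> u2i; have ga : (g i <= a)%O := co_supp cc (u2c i u2i).
  have gna : g i != a by apply/eqP => /v0; exact: u2c.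
  by have [gl|//] := lt_west_south ga gna; move: u2i; rewrite /u2 gl.
have [w1 w1E] := co_surj cc s1 f1.
have [w2 w2E] := co_surj cc s2 f2.
apply/in_INP; exists w1, w2; apply: co_eq => i.
rewrite co_D !(co_nat cc) w1E w2E /u1 /u2.
by case: ifP; rewrite ?addr0 ?add0r.
Qed.

End CoordinateLemmas.

(** * Comparing the ranks of two free modules *)

Section Enumeration.
Variables (T : Type) (A : set T).
Local Open Scope classical_set_scope.
Local Open Scope card_scope.

Definition enumerates (n : nat) (h : 'I_n -> T) : Prop :=
  [/\ injective h, forall k, A (h k) & forall x, A x -> exists k, h k = x].

Lemma card_eq_enumerates n : A #= `I_n -> exists h : 'I_n -> T, enumerates h.
Proof.
move=> /card_set_bijP[f [fA finj fsur]].
have hex (k : 'I_n) : exists x, A x /\ f x = k.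
  by have [x xA fx] := fsur k (ltn_ord k); exists x.
pose h k := projT1 (cid (hex k)).
have hA k : A (h k) := (projT2 (cid (hex k))).1.
have fh k : f (h k) = k := (projT2 (cid (hex k))).2.
exists h; split=> // [k l kl|x xA].
  by apply: val_inj; rewrite /= -!fh kl.
exists (Ordinal (fA x xA)); apply: finj; rewrite ?inE //; exact: fh.
Qed.

Lemma enumerates_card_eq n (h : 'I_n -> T) : enumerates h -> A #= `I_n.
Proof.
case=> hinj hA hsur; rewrite card_eq_sym (card_eql card_II).
have -> : A = range h.
  apply/seteqP; split=> [x /hsur[k <-]|_ [k _ <-]] //; by exists k.
by rewrite card_eq_sym; apply: inj_card_eq => k l _ _; exact: hinj.
Qed.

(** The basis of an arbitrary resolution may have any index type; this serves to show that only
    finitely many of its elements have a given grade. *)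
Lemma infinite_injection m :
  infinite_set A -> exists2 h : 'I_m -> T, injective h & forall k, A (h k).
Proof.
move=> /infiniteP/card_leP[f].
exists (fun k : 'I_m => set_val (f (SigSub (mem_setT (k : nat))))).
  move=> k l /val_inj/inj kl; apply: val_inj.
  by have /(congr1 val) := kl (mem_setT _) (mem_setT _).
by move=> k; exact: set_valP.
Qed.

End Enumeration.

(* [rho] induces an isomorphism between the quotient of [U] by [IU] and the
   homology quotient of the cycles [Z] by the boundaries [B]. *)
Record presents (F : fieldType) (U D : lmodType F) (IU : U -> Prop)
    (Z B : D -> Prop) (rho : U -> D -> Prop) : Prop := Presents {
  pr_lin : forall k u u' d d', rho u d -> rho u' d' -> rho (k *: u + u') (k *: d + d');
  pr_tot : forall u, exists d, rho u d;
  pr_cyc : forall u d, rho u d -> Z d;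
  pr_sur : forall d, Z d -> exists u, rho u d;
  pr_ker : forall u d, rho u d -> (IU u <-> B d) }.

Section Compare.
Variables (F : fieldType) (a : Z2) (D : lmodType F) (Z B : D -> Prop).
Local Open Scope classical_set_scope.
Local Open Scope card_scope.

(** Basis elements of [N] of grade [a] are carried through [D] to [N']. If there were more than [n]
    of them, a nontrivial combination would fall into [IN'], hence be a boundary, hence fall into
    [IN], against [co_IN]. *)
Lemma presents_card_le (N N' : pmod F) (I I' : Type) (g : I -> Z2) (g' : I' -> Z2)
    (rho : N a -> D -> Prop) (rho' : N' a -> D -> Prop) (m n : nat) (h : 'I_m -> I) :
  (exists c, is_coords (N := N) g c) -> (exists c', is_coords (N := N') g' c') ->
  presents (@in_IN F N a) Z B rho -> presents (@in_IN F N' a) Z B rho' ->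
  [set j | g' j = a] #= `I_n ->
  injective h -> (forall k, g (h k) = a) -> (m <= n)%N.
Proof.
case=> c cc [c' cc'] P P' /card_eq_enumerates[h' [_ h'a h'sur]] hinj hg.
rewrite leqNgt; apply/negP => nm.
(* The basis vector of index [h k], viewed at [a]. *)
have uex (k : 'I_m) : exists u : N a, forall i, c a u i = (`[< i = h k >])%:R.
  apply: (co_surj cc) => [i|].
    by case: asboolP => [-> _|//]; rewrite hg.
  apply: (@sub_finite_set _ _ [set h k]) => [i /=|]; last exact: finite_set1.
  by case: asboolP => [|//].
pose u k := projT1 (cid (uex k)).
have uE k i : c a (u k) i = (`[< i = h k >])%:R := projT2 (cid (uex k)) i.
have rex (k : 'I_m) : exists du : D * N' a, rho (u k) du.1 /\ rho' du.2 du.1.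
  have [d ud] := pr_tot P (u k).
  have [u' u'd] := pr_sur P' (pr_cyc P ud).
  by exists (d, u').
pose d k := (projT1 (cid (rex k))).1.
pose u' k := (projT1 (cid (rex k))).2.
have ud k : rho (u k) (d k) := (projT2 (cid (rex k))).1.
have u'd k : rho' (u' k) (d k) := (projT2 (cid (rex k))).2.
(* Rows are the carried vectors modulo [IN']. With more rows than columns the left kernel contains
   some [l <> 0]. *)
pose A := \matrix_(k < m, l < n) c' a (u' k) (h' l).
have /rowV0Pn[l /sub_kermxP lA l0] : kermx A != 0.
  by rewrite kermx_eq0 -row_leq_rank -ltnNge; apply: leq_ltn_trans nm; exact: rank_leq_col.
(* [r] is a relation, so [0] is reached by subtracting some related pair from itself. *)
have rho0 (V : lmodType F) (IU : V -> Prop) r : presents IU Z B r -> r 0 0.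
  move=> PV; have [e e0] := pr_tot PV 0.
  have := pr_lin PV (-1) e0 e0.
  by rewrite !scaleN1r !addNr.
have sumP (V : lmodType F) (IU : V -> Prop) r (w : 'I_m -> V) : presents IU Z B r ->
    (forall k, r (w k) (d k)) -> r (\sum_k l 0 k *: w k) (\sum_k l 0 k *: d k).
  move=> PV rw; elim/big_rec2: _ => [|k y z _ yz]; first exact: rho0 PV.
  exact: (pr_lin PV).
have su := sumP _ _ _ u P ud; have su' := sumP _ _ _ u' P' u'd.
have IN' : in_IN (\sum_k l 0 k *: u' k).
  apply/(co_IN cc') => i gi; rewrite (co_sum cc').
  have [p <-] := h'sur i gi.
  move/rowP: lA => /(_ p); rewrite !mxE => lA.
  rewrite -[RHS]lA; apply: eq_bigr => k _.
  by rewrite (co_Z cc') mxE.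
have : in_IN (\sum_k l 0 k *: u k) by apply/(pr_ker P su)/(pr_ker P' su').
move/(co_IN cc) => IN.
apply/negP: l0; rewrite negbK; apply/eqP/rowP => k; rewrite mxE.
rewrite -[RHS](IN _ (hg k)) (co_sum cc) (bigD1 k) //=.
rewrite (co_Z cc) uE asboolT // mulr1 big1 ?addr0 // => k' k'k.
rewrite (co_Z cc) uE asboolF ?mulr0 // => hk.
by move/eqP: k'k; apply; exact: hinj.
Qed.

Lemma presents_card_eq (N N' : pmod F) (I I' : Type) (g : I -> Z2) (g' : I' -> Z2)
    (rho : N a -> D -> Prop) (rho' : N' a -> D -> Prop) (n : nat) :
  free_on N g -> free_on N' g' ->
  presents (@in_IN F N a) Z B rho -> presents (@in_IN F N' a) Z B rho' ->
  [set j | g' j = a] #= `I_n -> [set j | g j = a] #= `I_n.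
Proof.
move=> /free_on_coords cN /free_on_coords cN' P P' Jn.
(* Otherwise [n.+1] elements of grade [a] could be chosen, more than [presents_card_le] allows. *)
have [m Jm] : finite_set [set j | g j = a].
  apply: contrapT => /(infinite_injection n.+1)[h hinj hg].
  by have := presents_card_le cN cN' P P' Jn hinj hg; rewrite ltnn.
have [h [hinj hg _]] := card_eq_enumerates Jm.
have [h' [h'inj hg' _]] := card_eq_enumerates Jn.
suff -> : n = m by [].
apply/eqP; rewrite eqn_leq (presents_card_le cN' cN P' P Jm h'inj hg').
exact: (presents_card_le cN cN' P P' Jn hinj hg).
Qed.

End Compare.

(** * Minimal resolutions and Koszul homology *)

Section KoszulHomology.
Variables (F : fieldType) (M : pmod F) (a : Z2).

Local Notation "v ^w" := (pm_map _ (west_le a) v) (at level 1, format "v ^w").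
Local Notation "v ^s" := (pm_map _ (south_le a) v) (at level 1, format "v ^s").
Local Notation "v ^sw" := (pm_map _ (southwest_west a) v)
  (at level 1, format "v ^sw").
Local Notation "v ^ss" := (pm_map _ (southwest_south a) v)
  (at level 1, format "v ^ss").

(** The Koszul complex of [M] at [a] runs from [M (southwest a)] to the sum of [M (west a)] and
    [M (south a)], by [w] to [(w, -w)], and then to [M a] by addition. *)
Definition koszul1_cycle (u : (M (west a) * M (south a))%type) : Prop :=
  u.1^w + u.2^s = 0.
Definition koszul1_boundary (u : (M (west a) * M (south a))%type) : Prop :=
  exists w : M (southwest a), u.1 = w^sw /\ u.2 = - w^ss.
Definition koszul2_cycle (u : M (southwest a)) : Prop := u^sw = 0 /\ u^ss = 0.

Lemma pm_square (N : pmod F) (w : N (southwest a)) : w^sw^w = w^ss^s.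
Proof. by rewrite !(pm_map_comp _ _ (southwest_le a)). Qed.

Variables (r : res_data M) (rmin : is_minimal_free_resolution r).

Let aug_sur b (m : M b) : exists v, res_aug r b v = m.
Proof. by case: rmin. Qed.
Let aug_ker b (v : r 0%N b) : res_aug r b v = 0 <-> exists w, res_d r 0%N b w = v.
Proof. by case: rmin. Qed.
Let d_ker i b (v : r i.+1 b) :
  res_d r i b v = 0 <-> exists w, res_d r i.+1 b w = v.
Proof. by case: rmin. Qed.
Let d_min i b (w : r i.+1 b) : in_IN (res_d r i b w).
Proof. by case: rmin. Qed.
Let aug_d b (w : r 1%N b) : res_aug r b (res_d r 0%N b w) = 0.
Proof. by apply/aug_ker; exists w. Qed.
Let d_d i b (w : r i.+2 b) : res_d r i b (res_d r i.+1 b w) = 0.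
Proof. by apply/d_ker; exists w. Qed.
Let r_coords i : exists I (g : I -> Z2) c, is_coords (N := r i) g c.
Proof.
by case: rmin => /(_ i)[I [g]] /free_on_coords[c cc] _ _ _ _; exists I, g, c.
Qed.
Let r_inj i x y (h : (x <= y)%O) : injective (pm_map (r i) h).
Proof. by have [I [g [c cc]]] := r_coords i; exact: free_map_inj cc _ _ h. Qed.
Let r_pullback i (v1 : r i (west a)) (v2 : r i (south a)) : v1^w = v2^s ->
  exists w : r i (southwest a), v1 = w^sw /\ v2 = w^ss.
Proof. by have [I [g [c cc]]] := r_coords i; exact: (free_pullback cc). Qed.

(* [rel0], [rel1], [rel2] are the zigzags of the double complex formed by the
   resolution and the Koszul complex at [a]. *)
Definition rel0 (z : r 0%N a) (m : M a) : Prop := res_aug r a z = m.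

Definition rel1 (z : r 1%N a) (u : (M (west a) * M (south a))%type) : Prop :=
  exists (v1 : r 0%N (west a)) (v2 : r 0%N (south a)),
    [/\ res_aug r _ v1 = u.1, res_aug r _ v2 = u.2 &
        res_d r 0%N a z = v1^w + v2^s].

Definition rel2 (z : r 2%N a) (u : M (southwest a)) : Prop :=
  exists (v : r 0%N (southwest a)) (w1 : r 1%N (west a)) (w2 : r 1%N (south a)),
    [/\ res_aug r _ v = u, res_d r 0%N _ w1 = v^sw, res_d r 0%N _ w2 = v^ss &
        res_d r 1%N a z = w1^w - w2^s].

Lemma presents0 : presents (@in_IN F (r 0%N) a) (fun=> True) (@in_IN F M a) rel0.
Proof.
split=> [k u u' d d' <- <-|u|//|d _|u d <-]; rewrite /rel0.
- by rewrite linearP.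
- by exists (res_aug r a u).
- exact: aug_sur.
split=> /in_INP[v1 [v2 E]].
  apply/in_INP; exists (res_aug r _ v1), (res_aug r _ v2).
  by rewrite E linearD !pm_nat.
have [w1 w1E] := aug_sur v1; have [w2 w2E] := aug_sur v2.
(* Two lifts of one element of [M a] differ by the image of some [y], which minimality places in
   [IF^0]. *)
have [y yE] : exists y, res_d r 0%N a y = u - (w1^w + w2^s).
  apply/aug_ker; rewrite linearB linearD !pm_nat w1E w2E.
  by rewrite E subrr.
have /in_INP[y1 [y2 yE']] := d_min y.
apply/in_INP; exists (y1 + w1), (y2 + w2).
by rewrite !linearD addrACA -yE' yE subrK.
Qed.

(** Minimality lets the differential of [z] split into a west and a south part; augmenting the parts
    gives the Koszul cycle. Two splittings differ by an element at [southwest a], that is, by a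
    Koszul boundary. *)
Lemma presents1 :
  presents (@in_IN F (r 1%N) a) koszul1_cycle koszul1_boundary rel1.
Proof.
split=> [k z z' u u' [v1 [v2 [E1 E2 E]]] [v1' [v2' [E1' E2' E']]]
        |z|z u [v1 [v2 [E1 E2 E]]]|u uc|z u [v1 [v2 [E1 E2 E]]]].
- exists (k *: v1 + v1'), (k *: v2 + v2').
  by rewrite !linearP E1 E1' E2 E2' E E' scalerDr addrACA.
- have /in_INP[v1 [v2 E]] := d_min z.
  by exists (res_aug r _ v1, res_aug r _ v2), v1, v2.
- by rewrite /koszul1_cycle -E1 -E2 -!pm_nat -linearD -E aug_d.
- have [v1 v1E] := aug_sur u.1; have [v2 v2E] := aug_sur u.2.
  have [z zE] : exists z, res_d r 0%N a z = v1^w + v2^s.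
    by apply/aug_ker; rewrite linearD !pm_nat v1E v2E.
  by exists z, v1, v2.
split=> [/in_INP[z1 [z2 zE]]|[w [w1 w2]]].
  (* The given splitting [v1], [v2] is compared with the one coming from [z1] and [z2]. *)
  have [w [wE1 wE2]] : exists w : r 0%N (southwest a),
      v1 - res_d r 0%N _ z1 = w^sw /\ res_d r 0%N _ z2 - v2 = w^ss.
    apply: r_pullback; rewrite !linearB -!pm_nat.
    apply/eqP; rewrite subr_eq addrAC eq_sym subr_eq.
    by rewrite addrC -linearD -zE E.
  exists (res_aug r _ w); rewrite -E1 -E2; split.
    by rewrite -pm_nat -wE1 linearB aug_d subr0.
  by rewrite -pm_nat -wE2 linearB aug_d sub0r opprK.
(* Correcting [v1] and [v2] by a lift of [w] makes both of them images under the differential. What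
   is left of [z] is a cycle, so a boundary, so in [IF^1] by minimality. *)
have [x xE] := aug_sur w.
have [z1 z1E] : exists z1, res_d r 0%N (west a) z1 = v1 - x^sw.
  by apply/aug_ker; rewrite linearB E1 pm_nat xE w1 subrr.
have [z2 z2E] : exists z2, res_d r 0%N (south a) z2 = v2 + x^ss.
  by apply/aug_ker; rewrite linearD E2 pm_nat xE w2 addNr.
have [y yE] : exists y, res_d r 1%N a y = z - (z1^w + z2^s).
  apply/d_ker; apply/eqP; rewrite linearB subr_eq0 E linearD !pm_nat z1E z2E.
  by rewrite linearB linearD pm_square addrACA addNr addr0.
have /in_INP[y1 [y2 yE']] := d_min y.
apply/in_INP; exists (y1 + z1), (y2 + z2).
by rewrite !linearD addrACA -yE' yE subrK.
Qed.

(** One step further down the same staircase. Degree two is the top of the Koszul complex, so the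
    only boundary is zero. *)
Lemma presents2 :
  presents (@in_IN F (r 2%N) a) koszul2_cycle (fun u => u = 0) rel2.
Proof.
split=> [k z z' u u' [v [w1 [w2 [E0 E1 E2 E]]]] [v' [w1' [w2' [E0' E1' E2' E']]]]
        |z|z u [v [w1 [w2 [E0 E1 E2 E]]]]|u [uw us]|z u [v [w1 [w2 [E0 E1 E2 E]]]]].
- exists (k *: v + v'), (k *: w1 + w1'), (k *: w2 + w2').
  rewrite !linearP E0 E0' E1 E1' E2 E2' E E'; split=> //.
  by rewrite scalerDr scalerN addrACA -opprD.
- have /in_INP[w1 [w2 E]] := d_min z.
  (* As the differential squares to zero, the images of the two parts cancel at [a] and the pullback
     applies. *)
  have [v [vE1 vE2]] : exists v : r 0%N (southwest a),
      res_d r 0%N _ w1 = v^sw /\ - res_d r 0%N _ w2 = v^ss.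
    apply: r_pullback; rewrite linearN -!pm_nat.
    by apply/eqP; rewrite -addr_eq0 -linearD -E d_d.
  exists (res_aug r _ v), v, w1, (- w2).
  by rewrite !linearN opprK.
- by rewrite /koszul2_cycle -E0 -!pm_nat -E1 -E2 !aug_d.
- have [v vE] := aug_sur u.
  have [w1 w1E] : exists w1, res_d r 0%N _ w1 = v^sw.
    by apply/aug_ker; rewrite pm_nat vE.
  have [w2 w2E] : exists w2, res_d r 0%N _ w2 = v^ss.
    by apply/aug_ker; rewrite pm_nat vE.
  have [z zE] : exists z, res_d r 1%N a z = w1^w - w2^s.
    by apply/d_ker; rewrite linearB !pm_nat w1E w2E pm_square subrr.
  by exists z, v, w1, w2.
split=> [/in_INP[z1 [z2 zE]]|u0].
  (* This [y] has differential [v], checked after the injective map to [west a]; hence [v] augments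
     to zero. *)
  have [y [yE1 yE2]] : exists y : r 1%N (southwest a),
      w1 - res_d r 1%N _ z1 = y^sw /\ w2 + res_d r 1%N _ z2 = y^ss.
    apply: r_pullback; rewrite linearB linearD -!pm_nat.
    apply/eqP; rewrite subr_eq -addrA -linearD [z2^s + _]addrC -zE E.
    by rewrite addrC subrK.
  rewrite -E0; apply/aug_ker; exists y; apply: (r_inj (h := southwest_west a)).
  by rewrite -pm_nat -yE1 linearB d_d subr0.
have [y yE] : exists y, res_d r 0%N _ y = v by apply/aug_ker; rewrite E0.
have [z1 z1E] : exists z1, res_d r 1%N _ z1 = w1 - y^sw.
  by apply/d_ker; rewrite linearB E1 pm_nat yE subrr.
have [z2 z2E] : exists z2, res_d r 1%N _ z2 = w2 - y^ss.
  by apply/d_ker; rewrite linearB E2 pm_nat yE subrr.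
have [x xE] : exists x, res_d r 2%N a x = z - (z1^w - z2^s).
  apply/d_ker; apply/eqP; rewrite linearB subr_eq0 E linearB !pm_nat z1E z2E.
  rewrite (linearB (pm_map _ (west_le a))) (linearB (pm_map _ (south_le a))).
  by rewrite pm_square opprB addrA subrK.
have /in_INP[x1 [x2 xE']] := d_min x.
apply/in_INP; exists (x1 + z1), (x2 - z2).
by rewrite !linearD linearN addrACA -xE' xE subrK.
Qed.

End KoszulHomology.

(** Both quotients of [F^i] by [IF^i] are identified with the same Koszul homology of [M]; the bound
    on [i] is the length of the Koszul complex. *)
Lemma minimal_resolution_unique (F : fieldType) (M : pmod F) (r r' : res_data M)
    (i : nat) (a : Z2) (n : nat) (I I' : Type) (g : I -> Z2) (g' : I' -> Z2) :
  is_minimal_free_resolution r -> is_minimal_free_resolution r' -> (i <= 2)%N ->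
  free_on (r i) g -> free_on (r' i) g' ->
  ([set j | g' j = a] #= `I_n)%classic%card -> ([set j | g j = a] #= `I_n)%classic%card.
Proof.
case: i => [|[|[|//]]] rm rm' _ rg rg'.
- exact: (presents_card_eq rg rg' (presents0 a rm) (presents0 a rm')).
- exact: (presents_card_eq rg rg' (presents1 a rm) (presents1 a rm')).
- exact: (presents_card_eq rg rg' (presents2 a rm) (presents2 a rm')).
Qed.

(** * Modules of subspaces *)

Definition nested (F : fieldType) (V : vectType F) (W : Z2 -> {vspace V}) : Prop :=
  forall x y, (x <= y)%O -> (W x <= W y)%VS.

Section SubspaceModule.
Variables (F : fieldType) (V : vectType F) (W : Z2 -> {vspace V}).
Hypothesis Wn : nested W.

Definition sub_obj (x : Z2) : lmodType F := subvs_of (W x).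

(** For a nested family this projection is the inclusion, see [sub_mapE]. *)
Definition sub_map (x y : Z2) (h : (x <= y)%O) : {linear sub_obj x -> sub_obj y} :=
  (vsproj (W y) \o vsval)%FUN.

Lemma sub_mapE x y (h : (x <= y)%O) v : vsval (sub_map h v) = vsval v.
Proof. by rewrite /= vsprojK //; apply: (subvP (Wn h)); exact: subvsP. Qed.

Lemma sub_map_id x (h : (x <= x)%O) v : sub_map h v = v.
Proof. by apply: val_inj; exact: sub_mapE. Qed.

Lemma sub_map_comp x y z (h1 : (x <= y)%O) (h2 : (y <= z)%O) (h3 : (x <= z)%O) v :
  sub_map h2 (sub_map h1 v) = sub_map h3 v.
Proof. by apply: val_inj; rewrite [LHS]sub_mapE [RHS]sub_mapE sub_mapE. Qed.

Definition sub_mod : pmod F := PMod sub_map_id sub_map_comp.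

End SubspaceModule.

Section SubspaceHom.
Variables (F : fieldType) (V V' : vectType F).
Variables (W : Z2 -> {vspace V}) (W' : Z2 -> {vspace V'}).
Hypotheses (Wn : nested W) (W'n : nested W').
Variable D : {linear V -> V'}.
Hypothesis DW : forall x v, v \in W x -> D v \in W' x.

Definition sub_hom_fun (x : Z2) : {linear sub_mod Wn x -> sub_mod W'n x} :=
  (vsproj (W' x) \o (D \o vsval))%FUN.

Lemma sub_hom_funE x (v : subvs_of (W x)) : vsval (sub_hom_fun x v) = D (vsval v).
Proof. by rewrite /= vsprojK // DW // subvsP. Qed.

Lemma sub_hom_nat (x y : Z2) (h : (x <= y)%O) (v : sub_mod Wn x) :
  sub_hom_fun y (pm_map _ h v) = pm_map (sub_mod W'n) h (sub_hom_fun x v).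
Proof.
apply: val_inj; rewrite [LHS]sub_hom_funE [RHS](sub_mapE W'n h) sub_hom_funE.
by congr (D _); exact: (sub_mapE Wn h).
Qed.

Definition sub_hom : pm_hom (sub_mod Wn) (sub_mod W'n) := PMHom sub_hom_nat.

End SubspaceHom.

Section FreeFamily.
Variables (F : fieldType) (V : vectType F) (U : {vspace V}).
Variables (I : finType) (P : {set I}) (b : I -> V).

Lemma dim_free_family :
  (forall k : I -> F, \sum_i k i *: b i = 0 -> forall i, k i = 0) ->
  (forall i, i \in P -> b i \in U) ->
  (forall v, v \in U -> exists2 k : I -> F, (forall i, k i <> 0 -> i \in P) &
     v = \sum_i k i *: b i) ->
  \dim U = #|P|.
Proof.
move=> bfree bU Ub.
pose s := [tuple b (enum_val i) | i < #|P|].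
have sfree : free s.
  apply/freeP => k k0 i.
  (* Extension of [k] by zero outside [P]; the match supplies the membership proof that
     [enum_rank_in] asks for. *)
  pose kk (j : I) := if j \in P =P true is ReflectT h then k (enum_rank_in h j) else 0.
  have kkE l : kk (enum_val l) = k l.
    rewrite /kk; case: eqP => [h|]; last by rewrite enum_valP.
    by rewrite enum_valK_in.
  rewrite -kkE; apply: (bfree kk).
  have kk0 j : j \notin P -> kk j = 0.
    by move=> jP; rewrite /kk; case: eqP => // h; rewrite h in jP.
  transitivity (\sum_(j in P) kk j *: b j).
    rewrite (bigID (mem P)) /= [X in _ + X]big1 ?addr0 // => j /kk0 ->.
    by rewrite scale0r.
  rewrite big_enum_val /= -[RHS]k0; apply: eq_bigr => l _.
  by rewrite kkE -[X in _ = _ *: X](tnth_nth 0) tnth_mktuple.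
suff -> : U = <<(s : seq V)>>%VS by rewrite (eqP sfree) size_tuple.
apply/eqP; rewrite eqEsubv; apply/andP; split.
  apply/subvP => v /Ub[k kx ->]; apply: memv_suml => j _.
  have [->|/eqP k0] := eqVneq (k j) 0; first by rewrite scale0r mem0v.
  have jP : j \in P by exact: kx.
  apply/memvZ/memv_span; apply/tnthP; exists (enum_rank_in jP j).
  by rewrite tnth_mktuple enum_rankK_in.
apply/span_subvP => v /tnthP[l ->]; rewrite tnth_mktuple.
by apply: bU; exact: enum_valP.
Qed.

End FreeFamily.

Section GradedBasis.
Variables (F : fieldType) (V : vectType F) (W : Z2 -> {vspace V}).
Variables (I : finType) (g : I -> Z2) (b : I -> V).

(** One family in the ambient space restricts to a basis of every [W x] at once. Coordinates then do
    not depend on [x], which makes [sub_mod] free. *)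
Record graded_basis : Prop := GradedBasis {
  gb_free : forall k : I -> F, \sum_i k i *: b i = 0 -> forall i, k i = 0;
  gb_mem : forall x i, (g i <= x)%O -> b i \in W x;
  gb_span : forall x v, v \in W x ->
    exists2 k : I -> F, (forall i, k i <> 0 -> (g i <= x)%O) & v = \sum_i k i *: b i }.

Hypothesis bP : graded_basis.

Lemma gb_inj (k k' : I -> F) :
  \sum_i k i *: b i = \sum_i k' i *: b i -> forall i, k i = k' i.
Proof.
move=> kk' i; apply/eqP; rewrite -subr_eq0; apply/eqP.
apply: (gb_free bP (k := fun i => k i - k' i)).
under eq_bigr do rewrite scalerBl.
by rewrite sumrB kk' subrr.
Qed.

Lemma gb_sum x (k : I -> F) :
  (forall i, k i <> 0 -> (g i <= x)%O) -> \sum_i k i *: b i \in W x.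
Proof.
move=> kx; apply: memv_suml => i _; have [->|/eqP k0] := eqVneq (k i) 0.
  by rewrite scale0r mem0v.
by apply: memvZ; apply: (gb_mem bP); exact: kx.
Qed.

Lemma gb_coords (Wn : nested W) : exists2 c : forall x, sub_mod Wn x -> I -> F,
  is_coords g c & forall x (v : subvs_of (W x)), vsval v = \sum_i c x v i *: b i.
Proof.
pose c x (v : subvs_of (W x)) : I -> F :=
  projT1 (cid2 (gb_span bP (subvsP v))).
have csupp x v i : c x v i <> 0 -> (g i <= x)%O.
  rewrite /c; case: cid2 => k /= kx _; exact: kx.
have cE x v : vsval v = \sum_i c x v i *: b i by rewrite /c; case: cid2.
exists c; last exact: cE.
split=> [x k u v i|x y h v i|x v i|x v|x v v0|x u ux ufin].
- apply: (gb_inj (k' := fun i => k * c x u i + c x v i)); rewrite -cE.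
  under eq_bigr do rewrite scalerDl -scalerA.
  by rewrite big_split /= -scaler_sumr -!cE.
- by apply: gb_inj; rewrite -!cE; exact: (sub_mapE Wn h).
- exact: csupp.
- exact: finite_finset.
- apply: val_inj; rewrite [LHS]cE big1 // => i _.
  by rewrite v0 scale0r.
- exists (vsproj (W x) (\sum_i u i *: b i)).
  by apply: gb_inj; rewrite -cE vsprojK // gb_sum.
Qed.

Lemma gb_free_on (Wn : nested W) : free_on (sub_mod Wn) g.
Proof. by have [c cc _] := gb_coords Wn; exact: coords_free_on cc. Qed.

Lemma gb_dim x : \dim (W x) = #|[set i | (g i <= x)%O]%SET|.
Proof.
apply: (dim_free_family (gb_free bP)) => [i|v /(gb_span bP)[k kx ->]].
  by rewrite inE; exact: (gb_mem bP).
by exists k => // i /kx; rewrite inE.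
Qed.

End GradedBasis.

Section VertexChains.
Variables (F : fieldType) (I : finType).

Lemma vertex_chainE (i j : I) : vertex_chain F i j = (j == i)%:R.
Proof. by rewrite ffunE. Qed.

Lemma vertex_chain_sum (u : {ffun I -> F^o}) : u = \sum_i u i *: vertex_chain F i.
Proof.
apply/ffunP => j; rewrite sum_ffunE (bigD1 j) //= big1 ?addr0.
  by rewrite !ffunE eqxx /GRing.scale /= mulr1.
move=> i ij; rewrite !ffunE eq_sym (negbTE ij) /GRing.scale /= mulr0 //.
Qed.

Lemma vertex_chain_free (k : I -> F) :
  \sum_i k i *: vertex_chain F i = 0 -> forall i, k i = 0.
Proof.
move=> k0 i; have := congr1 (fun u : {ffun I -> F^o} => u i) k0.
rewrite sum_ffunE (bigD1 i) //= big1 ?addr0.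
  by rewrite !ffunE eqxx /GRing.scale /= mulr1.
by move=> j ji; rewrite !ffunE eq_sym (negbTE ji) /GRing.scale /= mulr0.
Qed.

Lemma span_vertex_chain (P : pred I) (v : {ffun I -> F^o}) :
  v \in <<[seq vertex_chain F i | i <- enum I & P i]>>%VS -> forall i, v i <> 0 -> P i.
Proof.
move=> vW i; apply: contra_notT => Pi.
have evl : linear (fun u : {ffun I -> F^o} => u i : F^o).
  by move=> k u w; rewrite !ffunE.
pose ev := linfun (mk_linear evl).
have evE u : ev u = u i by rewrite lfunE.
suff : v \in lker ev by rewrite memv_ker evE => /eqP.
apply: subvP vW.
apply/span_subvP => _ /mapP[j + ->]; rewrite mem_filter => /andP[Pj _].
rewrite memv_ker evE vertex_chainE.
by have [ij|_] := eqVneq i j; [rewrite ij Pj in Pi | rewrite eqxx].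
Qed.

Lemma dim_span_vertex_chain (P : pred I) :
  \dim <<[seq vertex_chain F i | i <- enum I & P i]>> = #|[set i | P i]%SET|.
Proof.
apply: (dim_free_family vertex_chain_free) => [i|v /span_vertex_chain vP].
  by rewrite inE => Pi; apply: memv_span; apply: map_f; rewrite mem_filter Pi mem_enum.
exists (fun i => v i); last exact: vertex_chain_sum.
by move=> i /vP; rewrite inE.
Qed.

Lemma vertex_chain_graded_basis (g : I -> Z2) (W : Z2 -> {vspace {ffun I -> F^o}}) :
  (forall x, W x = <<[seq vertex_chain F i | i <- enum I & (g i <= x)%O]>>%VS) ->
  graded_basis W g (@vertex_chain F I).
Proof.
move=> WE; split=> [|x i gi|x v]; first exact: vertex_chain_free.
- by rewrite WE; apply: memv_span; apply: map_f; rewrite mem_filter gi mem_enum.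
rewrite WE => /span_vertex_chain vW.
by exists (fun i => v i); last exact: vertex_chain_sum.
Qed.

End VertexChains.

(** * Resolution by essential relations *)

Definition nat_grade (m d : nat) : Z2 := (m%:Z, d%:Z).

(* Relations [bd e] entering at grade [(m e, d e)], no two of them in the same
   row. A relation is essential if it does not follow from those of the earlier
   rows; an essential relation [e] gives a syzygy once it follows from relations
   of earlier rows, at the first column [syzygy_column e] where this happens. *)
Section Relations.
Variables (F : fieldType) (V : vectType F) (E : finType) (bd : E -> V).
Variables (m d : E -> nat).
Hypothesis d_inj : injective d.

Let g (e : E) : Z2 := nat_grade (m e) (d e).

Definition relations (x : Z2) : {vspace V} :=
  <<[seq bd e | e <- enum E & (g e <= x)%O]>>%VS.

Definition essential (e : E) : bool := bd e \notin relations (south (g e)).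

Definition ess_type : finType := {e : E | essential e}.

Lemma relations_nested : nested relations.
Proof.
move=> x y xy; apply/span_subvP => _ /mapP[e + ->].
rewrite mem_filter => /andP[ex _]; apply: memv_span; apply: map_f.
by rewrite mem_filter mem_enum andbT; apply: le_trans xy.
Qed.

Lemma mem_relations x e : (g e <= x)%O -> bd e \in relations x.
Proof. by move=> ex; apply: memv_span; apply: map_f; rewrite mem_filter ex mem_enum. Qed.

(** By induction on the row: an inessential relation is a combination of relations of strictly lower
    rows and no later columns. *)
Lemma relations_essential x :
  relations x = <<[seq bd (val e) | e <- enum ess_type & (g (val e) <= x)%O]>>%VS.
Proof.
apply/eqP; rewrite eqEsubv; apply/andP; split; last first.
  apply/span_subvP => _ /mapP[e + ->]; rewrite mem_filter => /andP[ex _].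
  exact: mem_relations.
apply/span_subvP => _ /mapP[e + ->]; rewrite mem_filter => /andP[+ _].
have [n] := ubnP (d e); elim: n e x => // n IH e x dn ex.
have [ess|] := boolP (essential e).
  apply: memv_span; apply/mapP; exists (exist _ e ess) => //.
  by rewrite mem_filter ex mem_enum.
rewrite negbK; apply: subvP; apply/span_subvP => _ /mapP[e' + ->].
rewrite mem_filter => /andP[e'e _]; apply: IH.
  by move: e'e dn; rewrite leZ2 /=; lia.
by apply: le_trans ex; apply: le_trans e'e (south_le _).
Qed.

Definition ess_space (x : Z2) : {vspace {ffun ess_type -> F^o}} :=
  <<[seq vertex_chain F e | e <- enum ess_type & (g (val e) <= x)%O]>>%VS.

Lemma ess_basis :
  graded_basis ess_space (fun e : ess_type => g (val e)) (@vertex_chain F ess_type).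
Proof. exact: vertex_chain_graded_basis. Qed.

Lemma ess_nested : nested ess_space.
Proof.
move=> x y xy; apply/span_subvP => _ /mapP[e + ->].
rewrite mem_filter => /andP[ex _]; apply: memv_span; apply: map_f.
by rewrite mem_filter mem_enum andbT; apply: le_trans xy.
Qed.

Lemma ess_spaceP x (u : {ffun ess_type -> F^o}) :
  u \in ess_space x <-> forall e, u e <> 0 -> (g (val e) <= x)%O.
Proof.
split=> [/(gb_span ess_basis)[k kx uk] e|ux].
  suff -> : u e = k e by apply: kx.
  by apply: (gb_inj ess_basis (k := u)); rewrite -vertex_chain_sum.
by rewrite [u]vertex_chain_sum; apply: (gb_sum ess_basis).
Qed.

Definition ess_bd_fun (u : {ffun ess_type -> F^o}) : V := \sum_e (u e : F) *: bd (val e).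

Lemma ess_bd_linear : linear ess_bd_fun.
Proof.
move=> k u v; rewrite /ess_bd_fun scaler_sumr -big_split; apply: eq_bigr => e _.
by rewrite !ffunE scalerDl scalerA.
Qed.

Definition ess_bd : {linear {ffun ess_type -> F^o} -> V} := mk_linear ess_bd_linear.

Lemma ess_bd_chain e : ess_bd (vertex_chain F e) = bd (val e).
Proof.
rewrite /= /ess_bd_fun (bigD1 e) //= big1 ?addr0.
  by rewrite vertex_chainE eqxx scale1r.
by move=> e' /negbTE ne; rewrite vertex_chainE ne scale0r.
Qed.

Lemma ess_bd_img x : (linfun ess_bd @: ess_space x)%VS = relations x.
Proof.
rewrite relations_essential limg_span -map_comp; congr <<_>>%VS.
apply: eq_map => e; exact: etrans (lfunE ess_bd _) (ess_bd_chain e).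
Qed.

Lemma ess_bd_mem x u : u \in ess_space x -> ess_bd u \in relations x.
Proof. by move=> ux; rewrite -ess_bd_img -(lfunE ess_bd) memv_img. Qed.

Lemma ess_bd_sur x v : v \in relations x -> exists2 u, u \in ess_space x & ess_bd u = v.
Proof. by rewrite -ess_bd_img => /memv_imgP[u ux ->]; exists u => //; rewrite lfunE. Qed.

Definition syz_space (x : Z2) : {vspace {ffun ess_type -> F^o}} :=
  (ess_space x :&: lker (linfun ess_bd))%VS.

Lemma syz_spaceP x u : u \in syz_space x <-> u \in ess_space x /\ ess_bd u = 0.
Proof.
rewrite memv_cap memv_ker lfunE.
by split=> [/andP[? /eqP]|[-> ->]]; rewrite ?eqxx.
Qed.

Lemma syz_nested : nested syz_space.
Proof.
move=> x y xy; apply/subvP => u /syz_spaceP[ux u0]; apply/syz_spaceP; split=> //.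
exact: (subvP (ess_nested xy)).
Qed.

Lemma dim_relations x : \dim (ess_space x) = (\dim (syz_space x) + \dim (relations x))%N.
Proof. by rewrite -(limg_ker_dim (linfun ess_bd) (ess_space x)) ess_bd_img. Qed.

Lemma ess_inj (e e' : ess_type) : d (val e) = d (val e') -> e = e'.
Proof. by move=> /d_inj ee; apply: val_inj. Qed.

(** By injectivity of [d], [e] is alone in the top row, so solving the syzygy for [bd (val e)] uses
    lower rows only. *)
Lemma syz_top x (u : {ffun ess_type -> F^o}) (e : ess_type) :
  u \in syz_space x -> u e <> 0 -> (d (val e))%:Z = x.2 -> bd (val e) \in relations (south x).
Proof.
move=> /syz_spaceP[/ess_spaceP ux u0] ue dx.
have bdE : u e *: bd (val e) = - \sum_(e' | e' != e) (u e' : F) *: bd (val e').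
  apply/eqP; rewrite -addr_eq0; apply/eqP.
  by rewrite -[RHS]u0 /= /ess_bd_fun [in RHS](bigD1 e).
rewrite -[bd _](scalerK (a := u e : F)) ?bdE; last exact/eqP.
apply/memvZ; rewrite memvN; apply: memv_suml => e' ne'.
have [->|/eqP ue'] := eqVneq (u e') 0; first by rewrite scale0r mem0v.
apply/memvZ/mem_relations; have := ux _ ue'.
have : d (val e') != d (val e) by apply: contra ne' => /eqP/ess_inj ->.
by move: dx; rewrite !leZ2 /=; lia.
Qed.

(** A nonzero coefficient would make [e] inessential by [syz_top]. This is minimality of the map
    from [F^2] to [F^1]. *)
Lemma syz_minimal x (u : {ffun ess_type -> F^o}) (e : ess_type) :
  u \in syz_space x -> g (val e) = x -> u e = 0.
Proof.
move=> ux ex; apply: contrapT => ue.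
have /negP := valP e; apply; rewrite ex; apply: syz_top ux ue _.
by rewrite -ex.
Qed.

Definition dies (e : ess_type) : Prop :=
  exists n : nat, bd (val e) \in relations (south (nat_grade n (d (val e)))).

Definition syz_type : finType := {e : ess_type | `[< dies e >]}.

Lemma syz_dies (e : syz_type) : dies (val e).
Proof. exact/asboolP/(valP e). Qed.

Definition syzygy_column (e : syz_type) : nat := ex_minn (syz_dies e).

Lemma syzygy_column_mem e :
  bd (val (val e)) \in relations (south (nat_grade (syzygy_column e) (d (val (val e))))).
Proof. by rewrite /syzygy_column; case: ex_minnP. Qed.

(** At a column no later than its own, the relation would follow from lower rows and fail to be
    essential. *)
Lemma syzygy_column_gt e : (m (val (val e)) < syzygy_column e)%N.
Proof.
rewrite ltnNge; apply/negP => te.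
have /negP := valP (val e); apply.
apply: (subvP _ _ (syzygy_column_mem e)); apply: relations_nested.
by move: te; rewrite leZ2 /=; lia.
Qed.

Definition syz_grade (e : syz_type) : Z2 := nat_grade (syzygy_column e) (d (val (val e))).

(** Equal rows force the same relation, whose syzygy lies strictly to its right. Disjointness of the
    supports of the first and second Betti numbers rests on this. *)
Lemma ess_syz_grade (e : ess_type) (e' : syz_type) : g (val e) <> syz_grade e'.
Proof.
case=> me; move/ess_inj => ee.
by have := syzygy_column_gt e'; rewrite -me ee ltnn.
Qed.

Lemma syzygy_exists (e : syz_type) :
  exists2 u : {ffun ess_type -> F^o}, u \in syz_space (syz_grade e) & u (val e) = 1.
Proof.
have [w wx wE] := ess_bd_sur (syzygy_column_mem e).
(* [w] lives in rows strictly below that of [e], so subtracting it keeps the leading coefficient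
   [1]. *)
have we : w (val e) = 0.
  by apply: contrapT; move/ess_spaceP: wx => wx /wx; rewrite leZ2 /=; lia.
exists (vertex_chain F (val e) - w); last by rewrite !ffunE eqxx we subr0.
apply/syz_spaceP; split; last by rewrite linearB ess_bd_chain wE subrr.
apply: rpredB; last exact: (subvP (ess_nested (south_le _))).
apply: (gb_mem ess_basis); have := syzygy_column_gt e.
by rewrite leZ2 /=; lia.
Qed.

Definition syzygy (e : syz_type) : {ffun ess_type -> F^o} :=
  projT1 (cid2 (syzygy_exists e)).

Lemma syzygy_mem e : syzygy e \in syz_space (syz_grade e).
Proof. by rewrite /syzygy; case: cid2. Qed.

Lemma syzygy1 e : syzygy e (val e) = 1.
Proof. by rewrite /syzygy; case: cid2. Qed.

Lemma syzygy_supp e e' : syzygy e e' <> 0 -> (d (val e') <= d (val (val e)))%N.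
Proof.
by have /syz_spaceP[/ess_spaceP ux _] := syzygy_mem e; move=> /ux; rewrite leZ2 /=; lia.
Qed.

(** Elimination of the top row; [n] bounds the rows that occur in [v]. *)
Lemma syz_span x n (v : {ffun ess_type -> F^o}) : v \in syz_space x ->
  (forall e, v e <> 0 -> (d (val e) < n)%N) ->
  exists2 k : syz_type -> F, (forall i, k i <> 0 -> (syz_grade i <= x)%O) &
    v = \sum_i k i *: syzygy i.
Proof.
elim: n v => [|n IH] v vx vn.
  exists (fun=> 0) => //; rewrite big1 => [|i _]; last exact: scale0r.
  by apply/ffunP => e; rewrite ffunE; apply: contrapT => /vn.
have [[e [ve de]]|] := pselect (exists e, v e <> 0 /\ d (val e) = n); last first.
  move=> /forallNP ne; apply: IH => // e ve.
  have := vn e ve; rewrite ltnS leq_eqVlt => /orP[/eqP de|//].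
  by case: (ne e).
have /syz_spaceP[/ess_spaceP vs v0] := vx.
have ex := vs e ve; have [x1 x1E] : exists p : nat, x.1 = p%:Z.
  by exists (absz x.1); move: ex; rewrite leZ2 /=; lia.
(* All rows of [v] are at most that of [e], so [v] is already a syzygy at column [x1] in the row of
   [e]. Minimality of [syzygy_column] then puts the syzygy of [e] below [x]. *)
have ed : bd (val e) \in relations (south (nat_grade x1 (d (val e)))).
  apply: (syz_top (u := v)) => //; apply/syz_spaceP; split=> //.
  apply/ess_spaceP => e' ve'; have := vs e' ve'; have := vn e' ve'.
  by move: de; rewrite !leZ2 /= x1E; lia.
have dieE : `[< dies e >] by apply/asboolP; exists x1.
pose e2 : syz_type := exist _ e dieE.
have e2x : (syz_grade e2 <= x)%O.
  have te : (syzygy_column e2 <= x1)%N by rewrite /syzygy_column; case: ex_minnP => p _; apply.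
  by move: ex; rewrite !leZ2 /= x1E; lia.
pose v' := v - (v e : F) *: syzygy e2.
have v'x : v' \in syz_space x.
  by apply: rpredB => //; apply: rpredZ; apply: (subvP (syz_nested e2x)); exact: syzygy_mem.
have v'n e' : v' e' <> 0 -> (d (val e') < n)%N.
  move=> ve'; rewrite ltn_neqAle; apply/andP; split.
    apply/eqP => de'; have ee' : e' = e by apply: ess_inj; rewrite de' de.
    apply: ve'; rewrite ee' !ffunE (syzygy1 e2) /GRing.scale /= mulr1 subrr //.
  rewrite leqNgt; apply/negP => nd; apply: ve'; rewrite !ffunE.
  have -> : v e' = 0 by apply: contrapT => /vn; rewrite ltnS leqNgt nd.
  have -> : syzygy e2 e' = 0 by apply: contrapT => /syzygy_supp; rewrite leqNgt de nd.
  by rewrite scaler0 subrr.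
have [k kx kE] := IH v' v'x v'n.
exists (fun i => k i + (if i == e2 then v e else 0)).
  move=> i; have [->//|ni] := eqVneq i e2; rewrite addr0; exact: kx.
under eq_bigr do rewrite scalerDl.
rewrite big_split /= -kE (bigD1 e2) //= eqxx big1 ?addr0 ?subrK //.
by move=> i /negbTE ->; rewrite scale0r.
Qed.

Lemma syz_basis : graded_basis syz_space syz_grade syzygy.
Proof.
split=> [k k0 i|x i ix|x v vx].
- apply: contrapT => /eqP ki.
  (* Triangularity: at the highest relation with nonzero coefficient, every other term of the sum
     vanishes. *)
  have [e ke emax] := @arg_maxnP _ i (fun i => k i != 0) (fun i => d (val (val i))) ki.
  have := congr1 (fun u : {ffun ess_type -> F^o} => u (val e)) k0.
  rewrite sum_ffunE (bigD1 e) //= big1 ?addr0.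
    rewrite !ffunE syzygy1 /GRing.scale /= mulr1; exact/eqP.
  move=> j je; rewrite !ffunE; have [->|kj] := eqVneq (k j) 0; first by rewrite scale0r.
  have -> : syzygy j (val e) = 0; last by rewrite scaler0.
  apply: contrapT => /syzygy_supp dej; have := emax j kj => dje.
  move/eqP: je; apply; apply: val_inj; apply: ess_inj.
  by apply/eqP; rewrite eqn_leq dej andbT; exact: dje.
- exact: (subvP (syz_nested ix) _ (syzygy_mem i)).
- apply: (@syz_span x (\max_e d e).+1) => // e _.
  by rewrite ltnS; exact: leq_bigmax.
Qed.

End Relations.

(** * The Rips filtration *)

Section RankedMetric.
Variables (R : realType) (X : finMetricType R) (f : X -> R).

Lemma mem_values x : f x \in sort <=%R (undup [seq f y | y : X]).
Proof. by rewrite mem_sort mem_undup fintype.image_f. Qed.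

Lemma mem_distances (x y : X) : x != y -> mdist x y \in nonzero_distances X.
Proof.
move=> xy; rewrite mem_sort mem_undup; apply/fintype.imageP.
by exists (x, y).
Qed.

Lemma dZ_gt0 (x y : X) : x != y -> (0 < dZ x y)%N.
Proof. by rewrite /dZ => /negbTE ->. Qed.

Lemma dZxx (x : X) : dZ x x = 0%N.
Proof. by rewrite /dZ eqxx. Qed.

Lemma dZC (x y : X) : dZ x y = dZ y x.
Proof. by rewrite /dZ eq_sym metric_sym. Qed.

Hypothesis f_generic : generic f.

Lemma fZ_inj : injective (fZ f).
Proof. move=> x y [] /(index_inj 0 (mem_values x) (mem_values y)); exact: f_generic.1. Qed.

Lemma dZ_inj (x y x' y' : X) : x != y -> x' != y' -> dZ x y = dZ x' y' ->
  [set x; y]%SET = [set x'; y']%SET.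
Proof.
move=> xy xy'; rewrite /dZ (negbTE xy) (negbTE xy') => -[].
by move=> /(index_inj 0 (mem_distances xy) (mem_distances xy')); exact: f_generic.2.
Qed.

(** Orienting edges towards the later vertex lists each unordered pair once and makes the second
    vertex decide the column of entry. *)
Definition edge_type : finType := {e : X * X | (fZ f e.1 < fZ f e.2)%N}.
Definition edge_index (e : edge_type) : nat := fZ f (val e).2.
Definition edge_length (e : edge_type) : nat := dZ (val e).1 (val e).2.

Lemma edge_neq (e : edge_type) : (val e).1 != (val e).2.
Proof. by have := valP e; apply: contraTneq => ->; rewrite ltnn. Qed.

(** Genericity yields equal unordered pairs, and the orientation excludes a swap. *)
Lemma edge_length_inj : injective edge_length.
Proof.
move=> e e' ee'; apply: val_inj.
have := dZ_inj (edge_neq e) (edge_neq e') ee'.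
have := valP e; have := valP e'.
case: (val e) (val e') => [x y] [x' y'] /= xy' xy exy.
have := set21 x y; have := set22 x y; rewrite exy !inE.
move=> /orP[]/eqP yE /orP[]/eqP xE; rewrite xE yE // in xy *.
- by rewrite ltnn in xy.
- by have := ltn_trans xy xy'; rewrite ltnn.
- by rewrite ltnn in xy.
Qed.

End RankedMetric.

Definition edge_bd (R : realType) (X : finMetricType R) (f : X -> R) (F : fieldType)
    (e : edge_type f) : {ffun X -> F^o} :=
  vertex_chain F (val e).2 - vertex_chain F (val e).1.

Notation edge_rel f F :=
  (relations (@edge_bd _ _ f F) (@edge_index _ _ f) (@edge_length _ _ f)).
Notation ess_edge f F :=
  (ess_type (@edge_bd _ _ f F) (@edge_index _ _ f) (@edge_length _ _ f)).
Notation syz_edge f F :=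
  (syz_type (@edge_bd _ _ f F) (@edge_index _ _ f) (@edge_length _ _ f)).
Notation ess_edge_space f F :=
  (ess_space (@edge_bd _ _ f F) (@edge_index _ _ f) (@edge_length _ _ f)).
Notation syz_edge_space f F :=
  (syz_space (@edge_bd _ _ f F) (@edge_index _ _ f) (@edge_length _ _ f)).
Notation edge_D f F :=
  (@ess_bd _ _ _ (@edge_bd _ _ f F) (@edge_index _ _ f) (@edge_length _ _ f)).

Section RipsResolution.
Variables (R : realType) (X : finMetricType R) (f : X -> R) (F : fieldType).
Hypothesis f_generic : generic f.

Definition vertex_grade (x : X) : Z2 := nat_grade (fZ f x) 0.

Lemma rips_vertex a x : ([set x]%SET \in simplices (rips f a)) = (vertex_grade x <= a)%O.
Proof.
rewrite inE leZ2 /=; apply/idP/idP.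
  case/and3P=> _ /forall_inP/(_ x (set11 x)) -> /forall_inP/(_ x (set11 x)).
  by move=> /forall_inP/(_ x (set11 x)); rewrite dZxx.
case/andP=> xa a0; apply/and3P; split.
- by apply/finset.set0Pn; exists x; rewrite set11.
- by apply/forall_inP => y /set1P ->.
- by apply/forall_inP => y /set1P ->; apply/forall_inP => z /set1P ->; rewrite dZxx.
Qed.

Lemma rips_edge a x y : x != y ->
  ([set x; y]%SET \in simplices (rips f a)) =
  [&& (fZ f x)%:Z <= a.1, (fZ f y)%:Z <= a.1 & (dZ x y)%:Z <= a.2].
Proof.
move=> xy; rewrite inE /=; apply/idP/idP.
  case/and3P=> _ /forall_inP hf /forall_inP/(_ x (set21 x y)) /forall_inP hd.
  by rewrite !hf ?hd ?inE ?eqxx ?orbT.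
case/and3P=> xa ya da; apply/and3P; split.
- by apply/finset.set0Pn; exists x; rewrite set21.
- by apply/forall_inP => z /set2P[] ->.
- have a0 : 0 <= a.2 by apply: le_trans da.
  apply/forall_inP => z /set2P[] ->; apply/forall_inP => t /set2P[] ->;
    by rewrite ?dZxx // dZC.
Qed.

Definition vertex_space (a : Z2) : {vspace {ffun X -> F^o}} := chains0 F (rips f a).

Lemma vertex_basis : graded_basis vertex_space vertex_grade (@vertex_chain F X).
Proof.
apply: vertex_chain_graded_basis => a; rewrite /vertex_space /chains0.
by congr <<map _ _>>%VS; apply: eq_filter => x; rewrite rips_vertex.
Qed.

Lemma vertex_nested : nested vertex_space.
Proof. by move=> a b ab; apply: chains0_sub; exact: filt_inc. Qed.

(** Edges have positive length while vertices enter in row zero, so endpoints are present one row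
    earlier. This gives minimality of the map from [F^1] to [F^0]. *)
Lemma edge_rel_vertex a : (edge_rel f F a <= vertex_space (south a))%VS.
Proof.
apply/span_subvP => _ /mapP[e + ->]; rewrite mem_filter => /andP[ea _].
have := dZ_gt0 (edge_neq e); have := valP e; move: ea.
rewrite leZ2 /= /edge_bd /edge_index /edge_length /= => ea me de.
by apply: rpredB; apply: (gb_mem vertex_basis); rewrite leZ2 /=; lia.
Qed.

Lemma edge_rel_chain a x y :
  (fZ f x)%:Z <= a.1 -> (fZ f y)%:Z <= a.1 -> (dZ x y)%:Z <= a.2 ->
  vertex_chain F y - vertex_chain F x \in edge_rel f F a.
Proof.
move=> xa ya da.
have [xy|yx|/(fZ_inj f_generic) ->] := ltngtP (fZ f x) (fZ f y); last first.
- by rewrite subrr mem0v.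
- rewrite -opprB memvN.
  have := @mem_relations F _ _ (@edge_bd R X f F) (@edge_index R X f) (@edge_length R X f) a.
  move=> /(_ (exist _ (y, x) yx)); apply.
  by rewrite leZ2 /edge_index /edge_length /= xa dZC da.
- have := @mem_relations F _ _ (@edge_bd R X f F) (@edge_index R X f) (@edge_length R X f) a.
  move=> /(_ (exist _ (x, y) xy)); apply.
  by rewrite leZ2 /edge_index /edge_length /= ya da.
Qed.

(** The boundaries are spanned by ordered pairs of both orientations, which changes only signs. The
    statement moves from the subspace type to the ambient space of chains. *)
Lemma boundaries0E a (c : subvs_of (vertex_space a)) :
  (c \in boundaries0 F (rips f a)) = (vsval c \in edge_rel f F a).
Proof.
pose valL : {linear subvs_of (vertex_space a) -> {ffun X -> F^o}} := vsval.
have sub : (edge_rel f F a <= vertex_space a)%VS.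
  exact: subv_trans (edge_rel_vertex a) (vertex_nested (south_le a)).
apply/idP/idP => [cB|].
  have : linfun valL c \in (linfun valL @: boundaries0 F (rips f a))%VS by exact: memv_img.
  rewrite lfunE; apply: subvP; rewrite limg_span.
  apply/span_subvP => _ /mapP[_ /mapP[e + ->] ->].
  rewrite mem_filter => /andP[/andP[ne eK] _]; rewrite lfunE.
  rewrite [X in X \in _](_ : _ = vertex_chain F e.2 - vertex_chain F e.1); last first.
    by apply: vsprojK; exact: vertex_chain_in.
  move: eK; rewrite rips_edge // => /and3P[? ? ?].
  exact: edge_rel_chain.
move=> cB; pose projL : {linear _ -> subvs_of (vertex_space a)} := vsproj (vertex_space a).
have : linfun projL (vsval c) \in (linfun projL @: edge_rel f F a)%VS by exact: memv_img.
rewrite lfunE [X in X \in _](vsvalK c); apply: subvP; rewrite limg_span.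
apply/span_subvP => _ /mapP[_ /mapP[e + ->] ->].
rewrite mem_filter => /andP[ea _]; rewrite lfunE.
apply: memv_span; apply/mapP; exists (val e) => //.
rewrite mem_filter mem_enum andbT (edge_neq e) rips_edge ?edge_neq //=.
have := valP e; move: ea; rewrite leZ2 /edge_index /edge_length /=.
by move=> /andP[ea -> me]; rewrite ea !andbT; move: ea me; lia.
Qed.

End RipsResolution.

Section RipsBetti.
Variables (R : realType) (X : finMetricType R) (f : X -> R) (F : fieldType).
Hypothesis f_generic : generic f.

Local Notation M := (H0 F (rips f)).

Definition aug_fun (a : Z2) : {linear sub_mod (vertex_nested f F) a -> M a} :=
  mk_linear (@vquot_pi_linear F _ (boundaries0 F (rips f a))).

Lemma aug_nat (a b : Z2) (h : (a <= b)%O) v :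
  aug_fun b (pm_map _ h v) = pm_map M h (aug_fun a v).
Proof. by symmetry; exact: vquot_mapE. Qed.

(** Placed among the essential chains so that its map into the syzygies is induced by the
    identity. *)
Definition zero_space (a : Z2) : {vspace {ffun ess_edge f F -> F^o}} := 0%VS.

Lemma zero_nested : nested zero_space.
Proof. by move=> a b _; exact: subvv. Qed.

Definition rips_mod (i : nat) : pmod F :=
  match i with
  | 0 => sub_mod (vertex_nested f F)
  | 1 => sub_mod (@ess_nested F _ _ (@edge_bd R X f F) (@edge_index R X f) (@edge_length R X f))
  | 2 => sub_mod (@syz_nested F _ _ (@edge_bd R X f F) (@edge_index R X f) (@edge_length R X f))
  | _ => sub_mod zero_nested
  end.

Lemma edge_D_vertex a u :
  u \in ess_edge_space f F a -> edge_D f F u \in vertex_space f F (south a).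
Proof. by move=> /ess_bd_mem; apply: subvP; exact: edge_rel_vertex. Qed.

Lemma edge_D_mem a u : u \in ess_edge_space f F a -> edge_D f F u \in vertex_space f F a.
Proof. by move=> /edge_D_vertex; apply: subvP; apply: vertex_nested; exact: south_le. Qed.

Lemma syz_ess a u : u \in syz_edge_space f F a -> idfun u \in ess_edge_space f F a.
Proof. by move=> /syz_spaceP[]. Qed.

Lemma zero_syz a u : u \in zero_space a -> idfun u \in syz_edge_space f F a.
Proof. by rewrite memv0 => /eqP ->; exact: mem0v. Qed.

Lemma zero_zero a u : u \in zero_space a -> idfun u \in zero_space a.
Proof. by []. Qed.

Definition rips_d (i : nat) : pm_hom (rips_mod i.+1) (rips_mod i) :=
  match i return pm_hom (rips_mod i.+1) (rips_mod i) with
  | 0 => sub_hom _ _ edge_D_mem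
  | 1 => sub_hom _ _ syz_ess
  | 2 => sub_hom _ _ zero_syz
  | _ => sub_hom _ _ zero_zero
  end.

Definition rips_res : res_data M := ResData rips_d (PMHom aug_nat).

Lemma zero_basis : graded_basis zero_space (fun v : void => match v with end)
  (fun v : void => match v with end).
Proof.
split=> [k _ []|x []|x v]; rewrite memv0 => /eqP ->.
by exists (fun=> 0) => //; rewrite big1 // => -[].
Qed.

Lemma rips_mod0_free : free_on (rips_mod 0) (vertex_grade f).
Proof. exact: (gb_free_on (vertex_basis f F)). Qed.

Lemma rips_mod1_free :
  free_on (rips_mod 1)
    (fun e : ess_edge f F => nat_grade (edge_index (val e)) (edge_length (val e))).
Proof. exact: (gb_free_on (ess_basis _ _ _)). Qed.

Lemma rips_mod2_free : free_on (rips_mod 2)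
  (@syz_grade F _ _ (@edge_bd R X f F) (@edge_index R X f) (@edge_length R X f)).
Proof. exact: (gb_free_on (syz_basis _ _ (edge_length_inj f_generic))). Qed.

Lemma zero_val a (v : subvs_of (zero_space a)) : vsval v = 0.
Proof. by apply/eqP; rewrite -memv0; exact: subvsP. Qed.

Lemma rips_res_minimal : is_minimal_free_resolution rips_res.
Proof.
split.
- case=> [|[|[|i]]].
  + by eexists; eexists; exact: rips_mod0_free.
  + by eexists; eexists; exact: rips_mod1_free.
  + by eexists; eexists; exact: rips_mod2_free.
  + by eexists; eexists; exact: (gb_free_on zero_basis).
- by move=> a m; exists (vquot_repr m); exact: vquot_reprK.
- move=> a v.
  have -> : (res_aug rips_res a v = 0) <-> v \in boundaries0 F (rips f a).
    have pi0 : vquot_pi (boundaries0 F (rips f a)) 0 = 0 := linear0 (aug_fun a).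
    by have := vquot_piP (boundaries0 F (rips f a)) v 0; rewrite subr0 pi0.
  rewrite boundaries0E //; split=> [/ess_bd_sur[u ux uE]|[w <-]].
    exists (vsproj (ess_edge_space f F a) u); apply: val_inj.
    by rewrite [LHS](sub_hom_funE _ _ edge_D_mem) vsprojK.
  rewrite [X in X \in _](sub_hom_funE _ _ edge_D_mem) ess_bd_mem //; exact: subvsP.
- case=> [|[|i]] a v.
  + split=> [v0|[w <-]].
      have vs : vsval v \in syz_edge_space f F a.
        apply/syz_spaceP; split; first exact: subvsP.
        rewrite -(sub_hom_funE (@ess_nested _ _ _ _ _ _) (vertex_nested f F) edge_D_mem).
        exact: (f_equal (fun q : subvs_of (vertex_space f F a) => vsval q) v0).
      exists (vsproj (syz_edge_space f F a) (vsval v)); apply: val_inj.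
      by rewrite [LHS](sub_hom_funE _ _ syz_ess) vsprojK.
    apply: val_inj; rewrite [LHS](sub_hom_funE _ _ edge_D_mem) (sub_hom_funE _ _ syz_ess).
    by have /syz_spaceP[] := subvsP w.
  + split=> [v0|[w <-]].
      exists 0; rewrite linear0; apply: val_inj.
      have := f_equal (fun q : subvs_of (ess_edge_space f F a) => vsval q) v0.
      by rewrite [LHS](sub_hom_funE _ _ syz_ess) => vs0; exact: esym vs0.
    apply: val_inj; rewrite [LHS](sub_hom_funE _ _ syz_ess) (sub_hom_funE _ _ zero_syz).
    exact: zero_val.
  + split=> [_|_]; last by case: i v => [|i] v; apply: val_inj;
      rewrite ?[LHS](sub_hom_funE _ _ zero_syz) ?[LHS](sub_hom_funE _ _ zero_zero); exact: zero_val.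
    by exists 0; rewrite linear0; apply: val_inj; rewrite [RHS]zero_val.
- case=> [|[|i]] a w.
  + apply/in_INP; exists 0, (vsproj _ (edge_D f F (vsval w))); rewrite linear0 add0r.
    apply: val_inj; rewrite [LHS](sub_hom_funE _ _ edge_D_mem).
    by rewrite [RHS](sub_mapE (vertex_nested f F)) vsprojK // edge_D_vertex // subvsP.
  (* By [co_IN], minimality means that coordinates of grade [a] vanish. These are the values of the
     chain on edges, by uniqueness of expansions, and [syz_minimal] applies. *)
  + have [c cc cE] := gb_coords
      (ess_basis (@edge_bd R X f F) (@edge_index R X f) (@edge_length R X f))
      (@ess_nested F _ _ (@edge_bd R X f F) (@edge_index R X f) (@edge_length R X f)).
    apply/(co_IN cc) => e ea.
    set v := res_d _ _ _ _.
    have vE : vsval v = vsval w by exact: (sub_hom_funE _ _ syz_ess).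
    have -> : c a v e = (vsval v : {ffun ess_edge f F -> F^o}) e.
      apply: (gb_inj (ess_basis (@edge_bd R X f F) _ _)); rewrite -cE.
      exact: vertex_chain_sum.
    rewrite vE; apply: (syz_minimal (edge_length_inj f_generic)) ea; exact: subvsP.
  + rewrite (_ : w = 0) ?linear0; first by move=> S [S0 _ _] _; exact: S0.
    by apply: val_inj; exact: zero_val.
Qed.

Lemma enumerates_fin (I : finType) (P : pred I) :
  enumerates [set i | P i]%classic (fun k : 'I_#|[set i | P i]%SET| => enum_val k).
Proof.
split=> [|k|x Px]; first exact: enum_val_inj.
  by have := enum_valP k; rewrite inE.
have xP : x \in [set i | P i]%SET by rewrite inE.
by exists (enum_rank_in xP x); rewrite enum_rankK_in.
Qed.

Lemma rips_graded_betti (a : Z2) (i : nat) (I : finType) (g : I -> Z2) :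
  (i <= 2)%N -> free_on (rips_mod i) g ->
  is_graded_betti M i a #|[set j | g j == a]%SET|.
Proof.
move=> i2 gfree; split; first by exists rips_res; exact: rips_res_minimal.
move=> r rmin J k kfree.
apply: (minimal_resolution_unique rmin rips_res_minimal i2 kfree gfree).
have -> : [set j | g j = a]%classic = [set j | g j == a]%classic.
  by apply/seteqP; split=> j /= /eqP.
exact: enumerates_card_eq (enumerates_fin _).
Qed.

End RipsBetti.

(** * Elder regions *)

Section ElderRank.
Variables (R : realType) (X : finMetricType R) (f : X -> R) (F : fieldType).
Hypothesis f_generic : generic f.

Definition elder_adj (a : Z2) : rel X :=
  [rel z z' | [&& (fZ f z)%:Z <= a.1, (fZ f z')%:Z <= a.1 & (dZ z z')%:Z <= a.2]].

Definition elderZ (x : X) (a : Z2) : bool :=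
  [&& 0 <= a.2, (fZ f x)%:Z <= a.1 &
      [forall y, connect (elder_adj a) x y ==> (fZ f x <= fZ f y)%N]].

Lemma elder_adj_sym a : connect_sym (elder_adj a).
Proof.
by apply: sym_connect_sym => x y; rewrite /elder_adj /= dZC andbCA.
Qed.

Definition elder_rep (a : Z2) (y : X) : X :=
  [arg min_(z < y | connect (elder_adj a) y z) fZ f z]%N.

Lemma elder_repP a y : connect (elder_adj a) y (elder_rep a y) /\
  forall z, connect (elder_adj a) y z -> (fZ f (elder_rep a y) <= fZ f z)%N.
Proof.
by rewrite /elder_rep; case: arg_minnP => //= i yi imin; split.
Qed.

Lemma elder_rep_unique a y z : connect (elder_adj a) y z ->
  (forall t, connect (elder_adj a) y t -> (fZ f z <= fZ f t)%N) -> elder_rep a y = z.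
Proof.
move=> yz zmin; have [yr rmin] := elder_repP a y.
by apply: (fZ_inj f_generic); apply/eqP; rewrite eqn_leq rmin //= zmin.
Qed.

Lemma elder_rep_connect a y z : connect (elder_adj a) y z -> elder_rep a y = elder_rep a z.
Proof.
move=> yz; have [zr rmin] := elder_repP a z; apply: elder_rep_unique.
  exact: connect_trans zr.
by move=> t yt; apply: rmin; apply: connect_trans yt; rewrite elder_adj_sym.
Qed.

Lemma elder_rep_elder a x : elderZ x a -> elder_rep a x = x.
Proof.
case/and3P=> _ _ /forallP xmin; apply: elder_rep_unique => // t xt.
by have /implyP := xmin t; apply.
Qed.

Lemma elder_elder_rep a y : (vertex_grade f y <= a)%O -> elderZ (elder_rep a y) a.
Proof.
rewrite leZ2 /= => /andP[ya a0]; have [yr rmin] := elder_repP a y.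
rewrite /elderZ a0 /=; apply/andP; split.
  by apply: le_trans ya; rewrite lez_nat rmin.
apply/forallP => z; apply/implyP => rz; apply: rmin.
exact: connect_trans rz.
Qed.

Lemma connect_edge_rel a x y : connect (elder_adj a) x y ->
  vertex_chain F y - vertex_chain F x \in edge_rel f F a.
Proof.
move=> /connectP[p + ->] {y}; elim: p x => [|z p IH] x /=; first by rewrite subrr mem0v.
case/andP=> /and3P[xa za da] /IH zp.
rewrite -[X in X \in _](subrKA (vertex_chain F z)) memvD //.
exact: edge_rel_chain.
Qed.

(** Moves every vertex to the oldest vertex of its component. On the chains at [a], the kernel is
    the space of relations and the image is spanned by the elders. *)
Definition collapse_fun (a : Z2) (u : {ffun X -> F^o}) : {ffun X -> F^o} :=
  \sum_y (u y : F) *: vertex_chain F (elder_rep a y).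

Lemma collapse_linear a : linear (collapse_fun a).
Proof.
move=> k u v; rewrite /collapse_fun scaler_sumr -big_split; apply: eq_bigr => e _.
by rewrite !ffunE scalerDl scalerA.
Qed.

Definition collapse a : {linear {ffun X -> F^o} -> {ffun X -> F^o}} :=
  mk_linear (collapse_linear a).

Lemma collapse_chain a y : collapse a (vertex_chain F y) = vertex_chain F (elder_rep a y).
Proof.
rewrite /= /collapse_fun (bigD1 y) //= big1 ?addr0.
  by rewrite vertex_chainE eqxx scale1r.
by move=> e' /negbTE ne; rewrite vertex_chainE ne scale0r.
Qed.

Lemma collapse_sub a u : u \in vertex_space f F a -> u - collapse a u \in edge_rel f F a.
Proof.
move=> ua; rewrite [u in u - _](vertex_chain_sum u) /= /collapse_fun -sumrB.
apply: memv_suml => y _; rewrite -scalerBr; apply: memvZ.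
apply: connect_edge_rel; rewrite elder_adj_sym; exact: (elder_repP a y).1.
Qed.

Lemma collapse_rel a u : u \in edge_rel f F a -> collapse a u = 0.
Proof.
move=> ua; suff : u \in lker (linfun (collapse a)).
  by rewrite memv_ker lfunE => /eqP.
apply: subvP ua; apply/span_subvP => _ /mapP[e + ->].
rewrite mem_filter memv_ker lfunE /edge_bd => /andP[ea _].
apply/eqP; rewrite linearB !collapse_chain (@elder_rep_connect _ (val e).1 (val e).2) ?subrr //.
apply: connect1; have := valP e; move: ea.
rewrite leZ2 /elder_adj /edge_index /edge_length /= => /andP[ea -> me].
by rewrite ea; move: ea me; lia.
Qed.

(** Rank and nullity of [collapse a]; the elders count the components. *)
Lemma dim_vertex_space a :
  \dim (vertex_space f F a) = (\dim (edge_rel f F a) + #|[set x | elderZ x a]%SET|)%N.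
Proof.
rewrite -(limg_ker_dim (linfun (collapse a)) (vertex_space f F a)); congr (_ + _)%N.
  congr (\dim _); apply/eqP; rewrite eqEsubv; apply/andP; split; apply/subvP => u.
    rewrite memv_cap memv_ker lfunE => /andP[/collapse_sub + /eqP u0].
    by rewrite [collapse a u]u0 subr0.
  move=> ua; rewrite memv_cap memv_ker lfunE [collapse a u]collapse_rel // eqxx andbT.
  apply: (subvP (vertex_nested f F (south_le a))).
  exact: (subvP (edge_rel_vertex f F a)).
rewrite -(dim_span_vertex_chain F (fun x => elderZ x a)); congr (\dim _).
rewrite /vertex_space /chains0 limg_span -map_comp.
apply/eqP; rewrite eqEsubv; apply/andP; split; apply/span_subvP => _ /mapP[x + ->];
  rewrite mem_filter => /andP[xa _].
  rewrite [X in X \in _](_ : _ = vertex_chain F (elder_rep a x)); last first.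
    exact: etrans (lfunE _ _) (collapse_chain a x).
  apply: memv_span; apply: map_f; rewrite mem_filter mem_enum andbT.
  by apply: elder_elder_rep; rewrite -rips_vertex.
apply: memv_span; apply/mapP; exists x.
  rewrite mem_filter mem_enum andbT rips_vertex leZ2 /=.
  by case/and3P: xa => -> ->.
by symmetry; apply: etrans (lfunE _ _) _; rewrite collapse_chain elder_rep_elder.
Qed.

End ElderRank.

(** * Corners of the elder regions *)

Section ElderCorners.
Variables (R : realType) (X : finMetricType R) (f : X -> R).

(** Membership sees [p] only through comparisons with natural numbers, so a real point may be
    replaced by any integer point giving the same comparisons. *)
Lemma elder_regionE x (a : Z2) (p : R * R) :
  (forall n : nat, (n%:R <= p.1) = (n%:Z <= a.1)) ->
  (forall n : nat, (n%:R <= p.2) = (n%:Z <= a.2)) ->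
  (p \in elder_region f x) = elderZ f x a.
Proof.
move=> p1 p2; rewrite /elder_region /elder_class /elderZ.
have conn : connect [rel z z' | [&& (fZ f z)%:R <= p.1, (fZ f z')%:R <= p.1
    & (dZ z z')%:R <= p.2]] =2 connect (elder_adj f a).
  by apply: eq_connect => z z'; rewrite /= !p1 p2.
apply/idP/idP; rewrite in_setE /= p1 (p2 0%N).
  case=> -> -> xmin; apply/forallP => y; apply/implyP => xy.
  by apply: xmin; rewrite inE conn.
case/and3P=> -> -> /forallP xmin; split=> // y; rewrite inE conn => xy.
by have /implyP := xmin y; apply.
Qed.

Lemma ler_nat_int (n : nat) (k : int) : (n%:R <= k%:~R :> R) = (n%:Z <= k).
Proof. by rewrite -(ler_int R). Qed.

Lemma ler_nat_int_sub (n : nat) (k : int) (t : R) : 0 < t -> t <= 1 ->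
  (n%:R <= k%:~R - t) = (n%:Z <= k - 1).
Proof.
move=> t0 t1; apply/idP/idP => [nk|].
  rewrite lerBrDr -ltzD1 ltrD2r -(ltr_int R).
  by apply: le_lt_trans nk _; rewrite gtrBl.
rewrite -(ler_int R) => /le_trans; apply.
by rewrite rmorphB lerD2l lerN2.
Qed.

Definition indicZ (x : X) (a : Z2) : R := (elderZ f x a)%:R.

Lemma indic_elder x (a : Z2) : \1_(elder_region f x) (a.1%:~R, a.2%:~R) = indicZ x a.
Proof.
rewrite indicE /indicZ; congr (nat_of_bool _)%:R.
by apply: elder_regionE => n; exact: ler_nat_int.
Qed.

(** For [0 < t <= 1], moving back by [t] from an integer point has the effect of a full unit step,
    so the function under the limit is constant near zero. The booleans select the direction. *)
Lemma indic_lim_elder x (a : Z2) (i j : bool) :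
  indic_lim (elder_region f x) (a.1%:~R, a.2%:~R) i%:R j%:R =
  indicZ x (a.1 - i%:Z, a.2 - j%:Z).
Proof.
apply: lim_near_cst; first exact: norm_hausdorff.
near=> t.
have t0 : 0 < t by near: t; exact: nbhs_right_gt.
have t1 : t <= 1 by near: t; exact: nbhs_right_le.
have shiftE (b : bool) (k : int) (n : nat) :
  (n%:R <= k%:~R - t * b%:R :> R) = (n%:Z <= k - b%:Z).
  by case: b; rewrite ?mulr1 ?mulr0 ?subr0 ?ler_nat_int ?ler_nat_int_sub.
rewrite indicE /indicZ; congr (nat_of_bool _)%:R.
by apply: elder_regionE => n; exact: shiftE.
Unshelve. all: by end_near.
Qed.

(** Components shrink as the grade decreases, so an elder stays one as long as it is present. *)
Lemma elderZ_down x (a b : Z2) : elderZ f x b -> (a <= b)%O ->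
  0 <= a.2 -> (fZ f x)%:Z <= a.1 -> elderZ f x a.
Proof.
case/and3P=> _ _ /forallP xmin /andP[ab1 ab2] a2 a1; rewrite /elderZ a2 a1 /=.
apply/forallP => y; apply/implyP => xy; have /implyP := xmin y; apply.
apply: connect_sub xy => z z' /and3P[za za' da]; apply: connect1.
by rewrite /elder_adj /= (le_trans za) // (le_trans za') // (le_trans da).
Qed.

Definition cornerZ (j : nat) (x : X) (a : Z2) : bool :=
  let: (i, l, b, d) := (elderZ f x a, elderZ f x (west a), elderZ f x (south a),
    elderZ f x (southwest a)) in
  match j with
  | 0 => [&& i, ~~ l, ~~ b & ~~ d]
  | 1 => i%:Z - l%:Z - b%:Z + d%:Z == -1
  | 2 => [&& ~~ i, ~~ l, ~~ b & d]
  | _ => false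
  end.

Lemma is_cornerE j x (a : Z2) :
  is_corner j (elder_region f x) (a.1%:~R, a.2%:~R) <-> cornerZ j x a.
Proof.
rewrite /is_corner indic_elder.
have -> := indic_lim_elder x a true false.
have -> := indic_lim_elder x a false true.
have -> := indic_lim_elder x a true true.
rewrite /indicZ /cornerZ !subr0 -/(west a) -/(south a) -/(southwest a).
have b0 (c : bool) : c%:R = 0 :> R <-> ~~ c.
  by case: c; split=> // /eqP; rewrite oner_eq0.
have b1 (c : bool) : c%:R = 1 :> R <-> c.
  by case: c; split=> // /eqP; rewrite eq_sym oner_eq0.
case: j => [|[|[|//]]].
- split=> [[/b1 -> /b0 -> /b0 -> /b0 ->]//|/and4P[/b1 ? /b0 ? /b0 ? /b0 ?]].
  by split.
- move: (elderZ f x a) (elderZ f x (west a)) (elderZ f x (south a))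
    (elderZ f x (southwest a)) => i l b d.
  have -> : i%:R - l%:R - b%:R + d%:R = (i%:Z - l%:Z - b%:Z + d%:Z)%:~R :> R.
    by rewrite !rmorphD !rmorphN /=.
  have -> : -1 = (-1)%:~R :> R by rewrite rmorphN.
  by split=> [/intr_inj ->|/eqP ->].
- split=> [[/b0 -> /b0 -> /b0 -> /b1 ->]//|/and4P[/b0 ? /b0 ? /b0 ? /b1 ?]].
  by split.
Qed.

Lemma elder_featureE j (a : Z2) : elder_feature f j a = #|[set x | cornerZ j x a]%SET|.
Proof.
rewrite /elder_feature; apply: eq_card => x; rewrite !inE.
by apply/idP/idP => [/asboolP/is_cornerE//|c]; apply/asboolP/is_cornerE.
Qed.

(** Checked on the sixteen patterns of membership. The patterns where the identity fails have [l]
    and [b] without [d], or [i] and [d] without [l] or without [b]; [elderZ_down] excludes them. *)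
Lemma corner_sum x a :
  (cornerZ 0 x a)%:Z - (cornerZ 1 x a)%:Z + (cornerZ 2 x a)%:Z =
  (elderZ f x a)%:Z - (elderZ f x (west a))%:Z - (elderZ f x (south a))%:Z
  + (elderZ f x (southwest a))%:Z.
Proof.
have lbd : elderZ f x (west a) -> elderZ f x (south a) -> elderZ f x (southwest a).
  move=> xw /and3P[a2 _ _]; have /and3P[_ a1 _] := xw.
  exact: (elderZ_down xw (southwest_west a)).
have idl : elderZ f x a -> elderZ f x (southwest a) -> elderZ f x (west a).
  move=> xa /and3P[_ a1 _]; have /and3P[a2 _ _] := xa.
  exact: (elderZ_down xa (west_le a)).
have idb : elderZ f x a -> elderZ f x (southwest a) -> elderZ f x (south a).
  move=> xa /and3P[a2 _ _]; have /and3P[_ a1 _] := xa.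
  exact: (elderZ_down xa (south_le a)).
move: lbd idl idb; rewrite /cornerZ.
case: (elderZ f x a) (elderZ f x (west a)) (elderZ f x (south a))
    (elderZ f x (southwest a)) => [] [] [] [] //= h1 h2 h3;
  by [have := h1 isT isT | have := h2 isT isT | have := h3 isT isT].
Qed.

Hypothesis f_generic : generic f.

Lemma corner0E x a : cornerZ 0 x a = (vertex_grade f x == a).
Proof.
apply/idP/eqP => [/and4P[xa xw xs _]|<-].
  have /and3P[a2 a1 _] := xa.
  have a2' : ~~ (0 <= a.2 - 1).
    by apply: contra xs => a2'; apply: (elderZ_down xa (south_le a)).
  have a1' : ~~ ((fZ f x)%:Z <= a.1 - 1).
    by apply: contra xw => a1'; apply: (elderZ_down xa (west_le a)).
  apply/eqP; rewrite Z2_eqE /=; case: a {xa xw xs} a1 a2 a1' a2' => p q /=.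
  by rewrite -!ltNge => *; apply/andP; split; lia.
apply/and4P; split; rewrite /elderZ /=; try by lia.
(* In row zero no two distinct points are adjacent, so the component of [x] is a single point. *)
rewrite lexx /=; apply/forallP => y; apply/implyP => /connectP[p + ->].
elim: p x => [|z p IH] x //= /andP[/and3P[_ _ dz]].
suff -> : z = x by exact: IH.
apply: contraTeq dz => zx; rewrite -ltNge ltz_nat dZ_gt0 //.
by rewrite eq_sym.
Qed.

End ElderCorners.

(** * Counting grades and corners *)

Lemma card_pred_sum (I : finType) (P : pred I) :
  (#|[set i | P i]%SET|%:Z = \sum_i (P i)%:Z)%R.
Proof.
rewrite -sum1dep_card big_mkcond (big_morph Posz PoszD (erefl (Posz 0))) /=.
by apply: eq_bigr => i _; case: (P i).
Qed.

Lemma second_difference (I : finType) (g : I -> Z2) (a : Z2) :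
  #|[set i | g i == a]%SET|%:Z =
  #|[set i | (g i <= a)%O]%SET|%:Z - #|[set i | (g i <= west a)%O]%SET|%:Z
  - #|[set i | (g i <= south a)%O]%SET|%:Z + #|[set i | (g i <= southwest a)%O]%SET|%:Z.
Proof.
rewrite !card_pred_sum -!sumrB -big_split /=; apply: eq_bigr => i _.
rewrite Z2_eqE !leZ2 /=; lia.
Qed.

Section RipsNumbers.
Variables (R : realType) (X : finMetricType R) (f : X -> R) (F : fieldType).
Hypothesis f_generic : generic f.

Definition ess_edge_grade (e : ess_edge f F) : Z2 :=
  nat_grade (edge_index (val e)) (edge_length (val e)).
Definition syz_edge_grade (e : syz_edge f F) : Z2 := syz_grade e.

(** Each count is the dimension at [a] of a term of the resolution, so this is its Euler
    characteristic. The dimension of the relations cancels between [dim_vertex_space] and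
    [dim_relations]. *)
Lemma euler_elder a :
  #|[set x | (vertex_grade f x <= a)%O]%SET|%:Z - #|[set e | (ess_edge_grade e <= a)%O]%SET|%:Z
  + #|[set e | (syz_edge_grade e <= a)%O]%SET|%:Z = #|[set x | elderZ f x a]%SET|%:Z.
Proof.
have d0 := gb_dim (vertex_basis f F) a.
have d1 := gb_dim (ess_basis (@edge_bd R X f F) (@edge_index R X f) (@edge_length R X f)) a.
have d2 := gb_dim (syz_basis (@edge_bd R X f F) (@edge_index R X f) (edge_length_inj f_generic)) a.
rewrite -[in X in X - _]d0 -[in X in _ - X]d1 -[in X in _ + X]d2.
rewrite (dim_vertex_space F f_generic) dim_relations.
lia.
Qed.

Lemma feature_sum a :
  (elder_feature f 0 a)%:Z - (elder_feature f 1 a)%:Z + (elder_feature f 2 a)%:Z =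
  #|[set x | elderZ f x a]%SET|%:Z - #|[set x | elderZ f x (west a)]%SET|%:Z
  - #|[set x | elderZ f x (south a)]%SET|%:Z + #|[set x | elderZ f x (southwest a)]%SET|%:Z.
Proof.
rewrite !elder_featureE !card_pred_sum -!sumrB -!big_split /=.
by apply: eq_bigr => x _; exact: corner_sum.
Qed.

Lemma feature0 a : elder_feature f 0 a = #|[set x | vertex_grade f x == a]%SET|.
Proof.
by rewrite elder_featureE; apply: eq_card => x; rewrite !inE corner0E.
Qed.

Lemma feature_difference a :
  (elder_feature f 1 a)%:Z - (elder_feature f 2 a)%:Z =
  #|[set e | ess_edge_grade e == a]%SET|%:Z - #|[set e | syz_edge_grade e == a]%SET|%:Z.
Proof.
have := feature_sum a; rewrite -!euler_elder feature0.
rewrite (second_difference (vertex_grade f)) (second_difference ess_edge_grade).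
by rewrite (second_difference syz_edge_grade); lia.
Qed.

Lemma ess_syz_disjoint a :
  #|[set e | ess_edge_grade e == a]%SET| = 0%N \/ #|[set e | syz_edge_grade e == a]%SET| = 0%N.
Proof.
have [->|/card_gt0P[e]] := posnP #|[set e | ess_edge_grade e == a]%SET|; first by left.
rewrite inE => /eqP ea; right; apply: eq_card0 => e'; rewrite inE.
apply/negP => /eqP e'a.
exact: (ess_syz_grade (edge_length_inj f_generic)) (etrans ea (esym e'a)).
Qed.

End RipsNumbers.

Theorem theorem5p4 (R : realType) (X : finMetricType R) (f : X -> R)
    (F : fieldType) (f_generic : generic f) (a : Z2) :
  [/\ is_graded_betti (H0 F (rips f)) 0 a (elder_feature f 0 a),
      is_graded_betti (H0 F (rips f)) 1 a
        (elder_feature f 1 a - elder_feature f 2 a)%N &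
      is_graded_betti (H0 F (rips f)) 2 a
        (elder_feature f 2 a - elder_feature f 1 a)%N].
Proof.
(* With one of [p], [q] zero, they are the positive and negative parts of the common difference,
   which is what truncated subtraction computes. *)
have trunc (p q u v : nat) : u%:Z - v%:Z = p%:Z - q%:Z -> p = 0%N \/ q = 0%N ->
  (u - v)%N = p /\ (v - u)%N = q by lia.
have [e1 e2] := trunc _ _ _ _ (feature_difference F f_generic a)
  (ess_syz_disjoint F f_generic a).
split.
- rewrite feature0 //.
  exact: (rips_graded_betti f_generic a (i := 0) isT (rips_mod0_free f F)).
- rewrite e1.
  exact: (rips_graded_betti f_generic a (i := 1) isT (rips_mod1_free f F)).
- rewrite e2.
  exact: (rips_graded_betti f_generic a (i := 2) isT (rips_mod2_free F f_generic)).
Qed.
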